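(* Let $G_A$ be a $2n$-dimensional almost abelian Lie group with Lie algebra $\mathfrak g_A=\mathbb R e_0\ltimes_A\mathfrak h$, where $A$ is a real diagonal $(2n-1)\times(2n-1)$ matrix, and let $k\in\{0,\dots,n\}$. Then $G_A$ admits a left-invariant generalized complex structure of type $k$ having a closed left-invariant pure-spinor generator if and only if the multiset of eigenvalues of $A$ (listed with multiplicity) can be reordered, for some real numbers $\lambda_i,\mu,\zeta_j$, in one of the following forms: (a) $\{\lambda_1,\lambda_1,\ldots,\lambda_k,\lambda_k,\ \mu,\ \zeta_1,-\zeta_1,\ldots,\zeta_{n-k-1},-\zeta_{n-k-1}\}$ with $k\le n-1$ and $\sum_{i=1}^k\lambda_i=0$; (b) $\{\lambda_1,\lambda_1,\ldots,\lambda_{k-1},\lambda_{k-1},\ \mu,\ \zeta_1,-\zeta_1,\ldots,\zeta_{n-k},-\zeta_{n-k}\}$ with $k\ge1$ and $\mu+\sum_{i=1}^{k-1}\lambda_i=0$.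
   Context: Almost abelian Lie groups: $\mathfrak g_A=\mathbb Re_0\ltimes_A\mathfrak h$ is the real Lie algebra with abelian ideal $\mathfrak h\cong\mathbb R^{2n-1}$ of codimension one and bracket $[e_0,v]=Av$ for $v\in\mathfrak h$, where $A$ is the matrix of $\mathrm{ad}_{e_0}|_{\mathfrak h}$ in a fixed basis of $\mathfrak h$; $G_A$ is the simply connected Lie group with Lie algebra $\mathfrak g_A$. Left-invariant generalized complex structures: for a Lie group $G$ with Lie algebra $\mathfrak g$ of real dimension $2n$, give $\mathfrak g\oplus\mathfrak g^*$ the pairing $\langle X+\xi,Y+\eta\rangle=\frac12(\xi(Y)+\eta(X))$. A left-invariant generalized complex structure on $G$ is (equivalently) a linear map $\mathcal J$ of $\mathfrak g\oplus\mathfrak g^*$ with $\mathcal J^2=-\mathrm{Id}$, orthogonal for the pairing, whose $\mathbf i$-eigenspace $L\subset(\mathfrak g\oplus\mathfrak g^* )\otimes\mathbb C$ is closed under the Courant bracket on left-invariant sections, $[[X+\xi,Y+\eta]]=[X,Y]+\mathrm{ad}^*_X\eta-\mathrm{ad}^*_Y\xi$, with $(\mathrm{ad}^*_X\eta)(Y)=-\eta([X,Y])$ (extended $\mathbb C$-bilinearly). The space $L$ is the annihilator, for the Clifford action $(X+\xi)\cdot\rho=\iota_X\rho+\xi\wedge\rho$, of a unique complex line $K_L\subset\bigwedge^\bullet\mathfrak g^*\otimes\mathbb C$. Any generator $\rho$ of $K_L$ (a left-invariant pure-spinor generator) has the form $\rho=\exp(B+\mathbf i\omega)\wedge\Omega$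 with $B,\omega\in\bigwedge^2\mathfrak g^*$ real and $\Omega=\theta_1\wedge\cdots\wedge\theta_k$ with linearly independent $\theta_i\in\mathfrak g^*\otimes\mathbb C$ ($\Omega$ a nonzero constant if $k=0$), and satisfies $\omega^{n-k}\wedge\Omega\wedge\overline\Omega\ne0$. The integer $k\in\{0,\dots,n\}$ is the type of $\mathcal J$. The generator is closed if $\mathrm d\rho=0$, where $\mathrm d$ is the de Rham differential on left-invariant forms, i.e. the derivation with $\mathrm d\xi(X,Y)=-\xi([X,Y])$ for $\xi\in\mathfrak g^*$. *)

(* Defs.v *)
From mathcomp Require Import all_boot all_order all_algebra.
From mathcomp Require Import reals complex.

Set Implicit Arguments.
Unset Strict Implicit.
Unset Printing Implicit Defensive.

Import GRing.Theory.
Local Open Scope ring_scope.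

(* Vectors of an m-dimensional Lie algebra g with basis e_i are columns of
   coordinates, and covectors are columns of coordinates in the dual basis e^i.
   The exterior algebra of g^* has as basis the monomials
   e^I = e^i1 /\ ... /\ e^ip, for I = {i1 < ... < ip}; a form is the family of
   its coefficients in this basis. *)
Section ExteriorAlgebra.
Variables (F : fieldType) (m : nat).

Definition form := {ffun {set 'I_m} -> F^o}.

Definition mono (I : {set 'I_m}) : form := [ffun J => (J == I)%:R].

Definition homogeneous (p : nat) (a : form) : Prop :=
  forall I : {set 'I_m}, a I != 0 -> #|I| = p.

Definition covec (xi : 'cV[F]_m) : form := \sum_i xi i 0 *: mono [set i].

(* For disjoint I and J, e^I /\ e^J = (-1)^(inversions I J) e^(I :|: J). *)
Definition inversions (I J : {set 'I_m}) : nat :=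
  #|[set p : 'I_m * 'I_m | [&& p.1 \in I, p.2 \in J & (p.2 < p.1)%N]]|.

Definition wedge (a b : form) : form :=
  [ffun K : {set 'I_m} => \sum_(I : {set 'I_m} | I \subset K)
     (-1) ^+ inversions I (K :\: I) * a I * b (K :\: I)].

Definition wedge_pow (a : form) (j : nat) : form := iter j (wedge a) (mono set0).

(* The exponential series; for a form of positive degree all the omitted terms
   vanish. *)
Definition wedge_exp (a : form) : form :=
  \sum_(j < m.+1) (j`!%:R)^-1 *: wedge_pow a j.

(* Interior product: iota_X e^I is the sum over i in I of
   (-1)^#{j in I | j < i} X_i e^(I :\ i). *)
Definition contract (X : 'cV[F]_m) (a : form) : form :=
  [ffun J : {set 'I_m} => \sum_(i : 'I_m | i \notin J)
     (-1) ^+ #|[set j in J | (j < i)%N]| * X i 0 * a (i |: J)].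

(* The de Rham differential of left-invariant forms, for the Lie bracket br:
   d e^k = sum_(i < j) - e^k([e_i, e_j]) e^i /\ e^j, extended as a derivation
   of degree 1. Since d e^k has even degree, the Leibniz rule on monomials
   reads d a = sum_k d e^k /\ iota_(e_k) a. *)
Definition d_basis (br : 'cV[F]_m -> 'cV[F]_m -> 'cV[F]_m) (k : 'I_m) : form :=
  \sum_(i : 'I_m) \sum_(j : 'I_m | (i < j)%N)
    - br (delta_mx i 0) (delta_mx j 0) k 0 *: mono [set i; j].

Definition d_form (br : 'cV[F]_m -> 'cV[F]_m -> 'cV[F]_m) (a : form) : form :=
  \sum_k wedge (d_basis br k) (contract (delta_mx k 0) a).

End ExteriorAlgebra.

(* Elements X + xi of g (+) g^* are block columns col_mx X xi. *)
Section DoubleSpace.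
Variables (F : fieldType) (m : nat).
Implicit Types (u v : 'cV[F]_(m + m)).

Definition ev (xi X : 'cV[F]_m) : F := (xi^T *m X) 0 0.

Definition pairing u v : F :=
  2^-1 * (ev (dsubmx u) (usubmx v) + ev (dsubmx v) (usubmx u)).

Definition coad (br : 'cV[F]_m -> 'cV[F]_m -> 'cV[F]_m)
    (X eta : 'cV[F]_m) : 'cV[F]_m :=
  \col_i - ev eta (br X (delta_mx i 0)).

Definition courant (br : 'cV[F]_m -> 'cV[F]_m -> 'cV[F]_m) u v :
    'cV[F]_(m + m) :=
  col_mx (br (usubmx u) (usubmx v))
         (coad br (usubmx u) (dsubmx v) - coad br (usubmx v) (dsubmx u)).

Definition clifford u (rho : form F m) : form F m :=
  contract (usubmx u) rho + wedge (covec (dsubmx u)) rho.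

End DoubleSpace.

(* The bracket of F e_0 |x_A h, h = F^N: [e_0, v] = A v and [v, w] = 0 for
   v, w in h. The coordinate along e_0 comes first. *)
Definition aa_bracket (F : fieldType) (N : nat) (A : 'M[F]_N)
    (x y : 'cV[F]_(1 + N)) : 'cV[F]_(1 + N) :=
  col_mx 0 (usubmx x 0 0 *: (A *m dsubmx y) - usubmx y 0 0 *: (A *m dsubmx x)).

Section GeneralizedComplex.
Variable R : realType.

Definition cplx_mx p q (M : 'M[R]_(p, q)) : 'M[R[i]]_(p, q) :=
  map_mx (real_complex R) M.

Definition cplx_form m (a : form R m) : form R[i] m :=
  [ffun I => real_complex R (a I)].

Definition conj_form m (a : form R[i] m) : form R[i] m :=
  [ffun I => conjc (a I)].

(* The i-eigenspace L of J in the complexification of g (+) g^*; a linear map J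
   of g (+) g^* is given by its matrix, acting on columns. *)
Definition i_eigen m (J : 'M[R]_(m + m)) (u : 'cV[R[i]]_(m + m)) : Prop :=
  cplx_mx J *m u = ('i)%C *: u.

(* Left-invariant generalized complex structures on G_A; the matrix cplx_mx A
   gives the C-bilinear extension of the bracket of g_A. *)
Definition gc_structure N (A : 'M[R]_N)
    (J : 'M[R]_((1 + N) + (1 + N))) : Prop :=
  [/\ J *m J = - 1%:M,
      forall u v, pairing (J *m u) (J *m v) = pairing u v
    & forall u v, i_eigen J u -> i_eigen J v ->
        i_eigen J (courant (aa_bracket (cplx_mx A)) u v)].

(* rho generates the line K_L whose annihilator is L. *)
Definition spinor_generator m (J : 'M[R]_(m + m)) (rho : form R[i] m) : Prop :=
  rho <> 0 /\ forall u, i_eigen J u <-> clifford u rho = 0.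

(* rho = exp(B + i omega) /\ Omega with Omega = c theta_1 /\ ... /\ theta_k; the
   scalar c can be absorbed into theta_1 unless k = 0, when Omega = c. Here the
   Lie algebra has dimension m = 2n. *)
Definition spinor_of_type (n k m : nat) (rho : form R[i] m) : Prop :=
  exists (B omega : form R m) (c : R[i]) (theta : k.-tuple 'cV[R[i]]_m),
    let Omega := c *: \big[@wedge _ m/mono _ set0]_(t <- theta) covec t in
    [/\ homogeneous 2 B /\ homogeneous 2 omega,
        c <> 0 /\ free theta,
        rho = wedge (wedge_exp (cplx_form B + ('i)%C *: cplx_form omega)) Omega
      & wedge (wedge_pow (cplx_form omega) (n - k))
          (wedge Omega (conj_form Omega)) <> 0].

Definition gc_type (n k m : nat) (J : 'M[R]_(m + m)) : Prop :=
  exists2 rho, spinor_generator J rho & spinor_of_type n k rho.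

Definition closed_spinor N (A : 'M[R]_N) (rho : form R[i] (1 + N)) : Prop :=
  d_form (aa_bracket (cplx_mx A)) rho = 0.

(* The multiset of eigenvalues of A, with multiplicity, is that listed by s. *)
Definition eigenvalues_listed N (A : 'M[R]_N) (s : seq R) : Prop :=
  char_poly A = \prod_(x <- s) ('X - x%:P).

Definition doubled (s : seq R) : seq R := flatten [seq [:: x; x] | x <- s].

Definition with_opposites (s : seq R) : seq R :=
  flatten [seq [:: x; - x] | x <- s].

End GeneralizedComplex.

(* Main.v *)
From HB Require Import structures.
From mathcomp Require Import all_boot all_order all_algebra.
From mathcomp Require Import reals complex.
From mathcomp Require Import ring zify.
Require Import Defs.

Set Implicit Arguments.
Unset Strict Implicit.
Unset Printing Implicit Defensive.

Import GRing.Theory.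
Local Open Scope ring_scope.

(** Why the theorem holds. Let a_1, ..., a_(2n-1) be the diagonal entries of A,
    the weights of the action of e_0 on h. On left-invariant forms d multiplies
    each monomial e^K of h^* by the sum of the a_i with i in K and wedges it
    with - e^0, and it kills the multiples of e^0 (d_formE). So closedness is a statement
    about the support of the spinor rho, the set of the K with rho_K <> 0: each
    member that avoids 0 has total weight zero (closedP).

    Necessity. The support of a pure spinor satisfies a symmetric exchange
    axiom (spinor_exchange): if K and K' are members and p is in their
    symmetric difference, some other q in it makes K with p and q toggled a
    member. The reason is that the annihilator L, being half-dimensional, is the
    graph of a map between two coordinate subspaces attached to K
    (i_eigen_graph); the entry of this map at (p, q) is, up to sign,
    the coefficient of rho at K with p and q toggled, divided by rho_K. The same
    argument shows that L determines rho up to a scalar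
    (pure_spinor_unique), so the closed generator has the support of the one
    that exhibits the type.

    For rho = exp(B + i w) /\ Omega of type k (spinor_of_type_facts), the
    members of the support have at least k elements, some member I0 with
    exactly k elements avoids 0, and, because w^(n-k) /\ Omega /\ conj Omega is
    the top coefficient of rho times a twisted conjugate of rho, some K and its
    complement are both members. Walk from K to I0 by exchanges. As all the
    sets met have weight zero, each step either discards two indices of
    opposite weights or replaces an index by one of I0 with the same weight
    (exchange_walk). Hence the weights of K are those of I0 and some pairs
    z, -z. The same holds for the complement of K, except that one of the two
    sets contains 0, which has no weight; the step that removes 0 tells which
    weight w0 it should be given (exchange_walk_o). Adding up, w0 and the a_i
    are together the weights of I0, twice, and n - k pairs z, -z; the weights
    of I0 add up to zero. If w0 is one of the doubled weights this is (b), and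
    if it is in a pair z, -z this is (a) (spectrum_shapes).

    Sufficiency. Conversely, such a list pairs up the basis e_0, ..., e_(2n-1):
    in k pairs (x, y) the weights are equal, in the others they are opposite.
    Put a complex structure on each of the former planes and a symplectic form
    on each of the latter. The corresponding generalized complex structure is
    integrable (paired_gc_structure) and its spinor is exp(i w) /\ Omega, with
    w the sum of the e^x /\ e^y over the latter pairs and Omega the product of
    the e^x + i e^y over the former. All the monomials of w have weight zero
    and all those of Omega the sum of the doubled weights, which is zero; so
    the spinor is closed. *)

(** * The exterior algebra as a ring *)

Section Inversions.
Variable m : nat.
Implicit Types I J K P Q : {set 'I_m}.

Lemma inversionsE I J :
  inversions I J = (\sum_(i in I) \sum_(j in J) (j < i))%N.
Proof.
rewrite /inversions -sum1_card pair_big_dep /= big_mkcond [RHS]big_mkcond /=.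
apply: eq_bigr => -[i j] _; rewrite inE /=.
by case: (i \in I); case: (j \in J); case: (j < i)%N.
Qed.

Lemma inversionsUl I P Q : [disjoint I & P] ->
  inversions (I :|: P) Q = (inversions I Q + inversions P Q)%N.
Proof.
move=> dIP; rewrite !inversionsE -bigU //=.
by apply: eq_bigl => i; rewrite !inE.
Qed.

Lemma inversionsUr I P Q : [disjoint P & Q] ->
  inversions I (P :|: Q) = (inversions I P + inversions I Q)%N.
Proof.
move=> dPQ; rewrite !inversionsE -big_split; apply: eq_bigr => i _ /=.
rewrite -bigU //=.
by apply: eq_bigl => j; rewrite !inE.
Qed.

(** Each pair in I x J is an inversion for exactly one of the two orders. *)
Lemma inversions_swap I J : [disjoint I & J] ->
  (inversions I J + inversions J I = #|I| * #|J|)%N.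
Proof.
move=> dIJ; rewrite !inversionsE [X in (_ + X)%N]exchange_big /=.
rewrite -big_split -sum_nat_const /=; apply: eq_bigr => i iI.
rewrite -big_split -sum1_card /=; apply: eq_bigr => j jJ.
case: ltngtP => // /ord_inj eq_ij.
by move: jJ; rewrite eq_ij (disjointFr dIJ).
Qed.

Lemma inversions0l J : inversions set0 J = 0%N.
Proof. by rewrite inversionsE big_set0. Qed.

Lemma inversions0r I : inversions I set0 = 0%N.
Proof. by rewrite inversionsE big1 // => i _; rewrite big_set0. Qed.

Lemma inversions1l i J : inversions [set i] J = #|[set j in J | (j < i)%N]|.
Proof.
rewrite inversionsE big_set1 -sum1_card big_mkcond [RHS]big_mkcond /=.
by apply: eq_bigr => j _; rewrite inE; case: (j \in J); case: (j < i)%N.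
Qed.

End Inversions.

Section Wedge.
Variables (F : fieldType) (m : nat).
Implicit Types (a b c : form F m) (I J K : {set 'I_m}).

Lemma wedgeE a b K : wedge a b K = \sum_(I : {set 'I_m} | I \subset K)
  (-1) ^+ inversions I (K :\: I) * a I * b (K :\: I).
Proof. by rewrite ffunE. Qed.

Lemma monoE I J : mono F I J = (J == I)%:R.
Proof. by rewrite ffunE. Qed.

Lemma formDE a b K : (a + b) K = a K + b K.
Proof. by rewrite ffunE. Qed.

Lemma formZE (x : F) a K : (x *: a) K = x * a K.
Proof. by rewrite ffunE. Qed.

(** Both sides expand over the ordered partitions of K into three parts; the
    signs agree because inversions are additive in both arguments. *)
Lemma wedgeA : associative (@wedge F m).
Proof.
move=> a b c; apply/ffunP => K; rewrite !wedgeE.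
under [RHS]eq_bigr => M MK do rewrite wedgeE big_distrr big_distrl /=.
rewrite (exchange_big_dep (fun I : {set 'I_m} => I \subset K)) /=; last first.
  by move=> M I MK IM; apply: subset_trans IM MK.
apply: eq_bigr => I IK; rewrite wedgeE big_distrr /=.
rewrite [RHS](reindex_onto (fun P => I :|: P) (fun M => M :\: I)) /=; last first.
  by move=> M /andP[_ IM]; apply/setP => i; rewrite !inE;
     case: (boolP (i \in I)) => //= /(subsetP IM) ->.
apply: eq_big => [P|P PKI].
  rewrite subsetU ?subxx // andbT subUset IK /= subsetD.
  rewrite setDUl setDv set0U disjoint_sym -setI_eq0 setIC.
  congr (_ && _); apply/eqP/eqP=> [|<-]; last by apply/setP=> i; rewrite !inE;
    case: (i \in I); rewrite ?andbF.
  by move=> h; apply/setP => i; have /setP/(_ i) := h; rewrite !inE; case: (i \in I);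
     case: (i \in P).
have dIP : [disjoint I & P].
  by move: PKI; rewrite subsetD => /andP[_]; rewrite disjoint_sym.
have -> : (I :|: P) :\: I = P.
  by rewrite setDUl setDv set0U; apply/setDidPl; rewrite disjoint_sym.
have EQ : K :\: (I :|: P) = (K :\: I) :\: P by rewrite setDDl.
have EKI : K :\: I = P :|: ((K :\: I) :\: P).
  by apply/setP => i; rewrite !inE; have /subsetP/(_ i) := PKI; rewrite !inE;
     case: (i \in P) => //= /(_ isT).
rewrite EQ inversionsUl // [in inversions I (K :\: I)]EKI inversionsUr; last first.
  by rewrite -setI_eq0; apply/eqP/setP => i; rewrite !inE; case: (i \in P).
rewrite !exprD; set x := _ :\: P; ring.
Qed.

Lemma wedge1l : left_id (mono F set0) (@wedge F m).
Proof.
move=> a; apply/ffunP => K;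
  rewrite wedgeE (bigD1 set0) ?sub0set //= big1 => [|I /andP[_ n0]].
  by rewrite addr0 monoE eqxx inversions0l setD0 expr0 !mul1r.
by rewrite monoE (negbTE n0) mulr0 mul0r.
Qed.

Lemma wedge1r : right_id (mono F set0) (@wedge F m).
Proof.
move=> a; apply/ffunP => K; rewrite wedgeE (bigD1 K) //= big1 => [|I /andP[sIK nIK]].
  by rewrite setDv addr0 monoE eqxx inversions0r expr0 mul1r mulr1.
rewrite monoE setD_eq0; case: (boolP (K \subset I)) => [sKI|]; last by rewrite mulr0.
by rewrite eqEsubset sIK sKI in nIK.
Qed.

Lemma wedgeDl : left_distributive (@wedge F m) +%R.
Proof.
move=> a b c; apply/ffunP => K; rewrite formDE !wedgeE -big_split /=.
by apply: eq_bigr => I _; rewrite ffunE mulrDr mulrDl.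
Qed.

Lemma wedgeDr : right_distributive (@wedge F m) +%R.
Proof.
move=> a b c; apply/ffunP => K; rewrite formDE !wedgeE -big_split /=.
by apply: eq_bigr => I _; rewrite ffunE mulrDr.
Qed.

Lemma wedgeZl (x : F) a b : x *: wedge a b = wedge (x *: a) b.
Proof.
apply/ffunP => K; rewrite formZE !wedgeE big_distrr; apply: eq_bigr => I _.
by rewrite formZE /= mulrA mulrCA.
Qed.

Lemma wedgeZr (x : F) a b : x *: wedge a b = wedge a (x *: b).
Proof.
apply/ffunP => K; rewrite formZE !wedgeE big_distrr; apply: eq_bigr => I _.
by rewrite formZE /= mulrCA.
Qed.

Lemma wedge0l a : wedge 0 a = 0.
Proof. by apply/ffunP => K; rewrite wedgeE big1 ?ffunE // => I _;
  rewrite ffunE mulr0 mul0r. Qed.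

Lemma wedge_suml (T : Type) (s : seq T) (P : pred T) (f : T -> form F m) b :
  wedge (\sum_(i <- s | P i) f i) b = \sum_(i <- s | P i) wedge (f i) b.
Proof. exact: (big_morph (fun x => wedge x b) (fun x y => wedgeDl x y b) (wedge0l b)). Qed.

Lemma mono_neq0 I : mono F I != 0.
Proof. by apply/eqP => /ffunP/(_ I)/eqP; rewrite monoE eqxx ffunE oner_eq0. Qed.

End Wedge.

(** A copy of the type of forms: finite functions already carry a pointwise
    product. *)
Definition exterior (F : fieldType) (m : nat) := form F m.
HB.instance Definition _ (F : fieldType) (m : nat) := GRing.Lmodule.copy (exterior F m) (form F m).
HB.instance Definition _ (F : fieldType) (m : nat) := GRing.Zmodule_isNzRing.Build (exterior F m)
  (@wedgeA F m) (@wedge1l F m) (@wedge1r F m) (@wedgeDl F m) (@wedgeDr F m)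
  (mono_neq0 F set0).
HB.instance Definition _ (F : fieldType) (m : nat) :=
  GRing.Lmodule_isLalgebra.Build F (exterior F m) (@wedgeZl F m).
HB.instance Definition _ (F : fieldType) (m : nat) :=
  GRing.Lalgebra_isAlgebra.Build F (exterior F m) (@wedgeZr F m).

(** * Gradings *)

Section Grading.
Variables (F : fieldType) (m : nat).
Implicit Types (a b : exterior F m) (I J K : {set 'I_m}).

Lemma mono_supp I K : mono F I K != 0 -> K = I.
Proof. by rewrite monoE; case: (K =P I) => // _; rewrite eqxx. Qed.

Lemma wedge_supp a b K : (a * b) K != 0 ->
  exists I, [/\ I \subset K, a I != 0 & b (K :\: I) != 0].
Proof.
rewrite /= [(a * b) K]wedgeE => nz.
case: (pickP [pred I : {set 'I_m} | [&& I \subset K, a I != 0 & b (K :\: I) != 0]]).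
  by move=> I /and3P[*]; exists I.
move=> z; case/eqP: nz; apply: big1 => I sIK; have := z I; rewrite /= sIK /=.
by have [->|_ /= /negbFE/eqP->] := eqVneq (a I) 0; rewrite ?mulr0 ?mul0r.
Qed.

Section Weights.
Variables (V : nmodType) (W : 'I_m -> V).
Implicit Types v w : V.

Definition weight K := \sum_(i in K) W i.

(** Exterior degree is the case of constant weight 1; the other weights used are
    those of the action of e_0. *)
Definition graded w (a : form F m) := forall K, a K != 0 -> weight K = w.

Lemma weightD I K : I \subset K -> weight K = weight I + weight (K :\: I).
Proof.
move=> sIK; rewrite /weight (big_setID I) /=; congr (_ + _).
by apply: eq_bigl => i; rewrite (setIidPr sIK).
Qed.

Lemma graded1 : graded 0 (1 : exterior F m).
Proof. by move=> K /mono_supp->; rewrite /weight big_set0. Qed.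

Lemma graded0 w : graded w (0 : exterior F m).
Proof. by move=> K; rewrite ffunE eqxx. Qed.

Lemma gradedD w a b : graded w a -> graded w b -> graded w (a + b).
Proof.
move=> ga gb K; rewrite formDE => nz; have [a0|/ga//] := eqVneq (a K) 0.
by apply: gb; move: nz; rewrite a0 add0r.
Qed.

Lemma gradedZ w (x : F) a : graded w a -> graded w (x *: a).
Proof. by move=> ga K; rewrite formZE mulf_eq0 negb_or => /andP[_ /ga]. Qed.

Lemma gradedM v w a b : graded v a -> graded w b -> graded (v + w) (a * b).
Proof.
by move=> ga gb K /wedge_supp[I [sIK /ga aI /gb bI]]; rewrite (weightD sIK) aI bI.
Qed.

Lemma graded_sum (T : Type) (s : seq T) (P : pred T) w (f : T -> exterior F m) :
  (forall i, P i -> graded w (f i)) -> graded w (\sum_(i <- s | P i) f i).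
Proof.
move=> gf; elim/big_ind: _ => //; [exact: graded0 | exact: gradedD].
Qed.

Lemma graded_prod (T : Type) (s : seq T) (P : pred T) (w : T -> V)
    (f : T -> exterior F m) :
  (forall i, P i -> graded (w i) (f i)) ->
  graded (\sum_(i <- s | P i) w i) (\prod_(i <- s | P i) f i).
Proof.
move=> gf; elim/big_ind2: _ => //; [exact: graded1 | move=> *; exact: gradedM].
Qed.

Lemma gradedX w a j : graded w a -> graded (w *+ j) (a ^+ j).
Proof.
move=> ga; elim: j => [|j IH]; first exact: graded1.
by rewrite exprS mulrS; apply: gradedM.
Qed.

End Weights.

Lemma homogeneousP p a :
  homogeneous p a <-> graded (fun=> 1%N : nat) (p : nat) a.
Proof.
by split=> h K /h; rewrite /weight (_ : \sum_(i in K) 1%N = #|K|) //= sum1_card.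
Qed.

End Grading.

(** * Signs, coefficient twists and the exponential *)

Section Homogeneous.
Variables (F : fieldType) (m : nat).
Implicit Types (a b : exterior F m) (I J K : {set 'I_m}).

Lemma homogeneousM p q a b :
  homogeneous p a -> homogeneous q b -> homogeneous (p + q) (a * b).
Proof. by rewrite !homogeneousP => ha hb; apply: gradedM. Qed.

Lemma homogeneousZ p (x : F) a : homogeneous p a -> homogeneous p (x *: a).
Proof. by rewrite !homogeneousP; apply: gradedZ. Qed.

Lemma homogeneousD p a b :
  homogeneous p a -> homogeneous p b -> homogeneous p (a + b).
Proof. by rewrite !homogeneousP; apply: gradedD. Qed.

Lemma homogeneousX p a j : homogeneous p a -> homogeneous (p * j) (a ^+ j).
Proof.
rewrite !homogeneousP => /(gradedX (j := j)).
suff -> : (p : nat) *+ j = (p * j)%N by [].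
by elim: j => [|j IH]; rewrite ?muln0 ?mulnS ?mulrS ?IH.
Qed.

Lemma homogeneous_covec (xi : 'cV[F]_m) : homogeneous 1 (covec xi).
Proof.
rewrite homogeneousP; apply: graded_sum => i _; apply: gradedZ.
move=> K /mono_supp->; by rewrite /weight big_set1.
Qed.

Lemma homogeneous_prod_covec (s : seq 'cV[F]_m) :
  homogeneous (size s) (\prod_(t <- s) (covec t : exterior F m)).
Proof.
elim: s => [|t s IH]; first by rewrite big_nil homogeneousP; apply: graded1.
by rewrite big_cons; apply: (homogeneousM (p := 1)) => //; apply: homogeneous_covec.
Qed.

(** A form of top degree is a multiple of the volume form. *)
Lemma homogeneous_top a : homogeneous m a -> a <> 0 -> a setT != 0.
Proof.
move=> ha nz; apply/eqP => aT; apply: nz; apply/ffunP => K; rewrite ffunE.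
apply/eqP; have [//|nz] := eqVneq (a K) 0; have := ha K nz.
move=> cK; have KT : K = setT by apply/eqP;
  rewrite eqEcard subsetT cardsT card_ord cK leqnn.
by rewrite KT aT eqxx in nz.
Qed.

Lemma homogeneous_eq0 p a : homogeneous p a -> (m < p)%N -> a = 0.
Proof.
move=> ha lt_mp; apply/ffunP => K; rewrite ffunE; apply/eqP.
have [//|/ha cK] := eqVneq (a K) 0.
by have := max_card (mem K); rewrite card_ord cK leqNgt lt_mp.
Qed.

Lemma wedge_supercomm p q a b : homogeneous p a -> homogeneous q b ->
  a * b = (-1) ^+ (p * q) *: (b * a).
Proof.
move=> ha hb; apply/ffunP => K; rewrite formZE [LHS]wedgeE [(b * a) K]wedgeE.
rewrite big_distrr /= (reindex_onto (fun I => K :\: I) (fun I => K :\: I)) /=; last first.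
  by move=> I sIK; rewrite setDDr setDv set0U (setIidPr sIK).
have eqK I : (K :\: I \subset K) && (K :\: (K :\: I) == I) = (I \subset K).
  by rewrite subsetDl setDDr setDv set0U /= (sameP setIidPr eqP).
rewrite (eq_bigl _ _ eqK); apply: eq_bigr => I sIK.
rewrite setDDr setDv set0U (setIidPr sIK).
have [-> | nza] := eqVneq (a (K :\: I)) 0; first by rewrite !(mulr0, mul0r).
have [-> | nzb] := eqVneq (b I) 0; first by rewrite !(mulr0, mul0r).
have dI : [disjoint I & K :\: I] 
  by rewrite -setI_eq0; apply/eqP/setP => i; rewrite !inE; case: (i \in I).
rewrite -(ha _ nza) -(hb _ nzb) mulnC -(inversions_swap dI) exprD.
rewrite -(mulrA _ (b I)) (mulrC (b I)) !mulrA; congr (_ * _ * _).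
by rewrite mulrAC -expr2 sqrr_sign mul1r.
Qed.

(** Supercommutativity is stated for homogeneous forms, so the arbitrary factor
    is split into its monomials first. *)
Lemma even_comm p a b : homogeneous p a -> ~~ odd p -> GRing.comm a b.
Proof.
move=> ha ev.
have hb J : homogeneous #|J| (b J *: mono F J : exterior F m).
  by apply: homogeneousZ => K /mono_supp->.
have -> : b = \sum_J b J *: mono F J.
  apply/ffunP => K; rewrite sum_ffunE (bigD1 K) //= big1 => [|J nJK].
    by rewrite addr0 formZE monoE eqxx mulr1.
  by rewrite formZE monoE eq_sym (negbTE nJK) mulr0.
rewrite /GRing.comm big_distrl big_distrr; apply: eq_bigr => J _ /=.
by rewrite (wedge_supercomm ha (hb J)) -signr_odd oddM (negbTE ev) expr0 scale1r.
Qed.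

End Homogeneous.

Section Twist.
Variables (F G : fieldType) (m : nat) (f : {rmorphism F -> G}) (t : G).
Implicit Types (a b : exterior F m).

(** With f the complex conjugation and t = i this sends b to - conj b on
    2-forms, so it turns exp(b) into exp(- conj b) while keeping the
    support; with t = 1 it is conjugation, or complexification. *)
Definition twist a : exterior G m := [ffun K : {set 'I_m} => t ^+ #|K| * f (a K)].

Lemma twistE a K : twist a K = t ^+ #|K| * f (a K).
Proof. by rewrite ffunE. Qed.

Lemma twistD a b : twist (a + b) = twist a + twist b.
Proof.
by apply/ffunP => K; rewrite formDE !twistE formDE rmorphD mulrDr.
Qed.

Lemma twist0 : twist 0 = 0.
Proof. by apply/ffunP => K; rewrite !ffunE rmorph0 mulr0. Qed.

Lemma twistZ (x : F) a : twist (x *: a) = f x *: twist a.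
Proof.
by apply/ffunP => K; rewrite formZE !twistE formZE rmorphM mulrCA.
Qed.

Lemma twist1 : twist 1 = 1.
Proof.
apply/ffunP => K; rewrite twistE !monoE; case: eqP => [->|_] /=.
  by rewrite cards0 rmorph1 mulr1.
by rewrite rmorph0 mulr0.
Qed.

Lemma twistM a b : twist (a * b) = twist a * twist b.
Proof.
apply/ffunP => K; rewrite twistE [(a * b) K]wedgeE [RHS]wedgeE rmorph_sum big_distrr.
apply: eq_bigr => I sIK /=; rewrite !rmorphM rmorph_sign !twistE.
rewrite -(cardsID I K) (setIidPr sIK) exprD.
move: (_ ^+ inversions _ _) (f (a I)) (f (b _)) => /= s y z; ring.
Qed.

Lemma twistX a j : twist (a ^+ j) = twist a ^+ j.
Proof. by elim: j => [|j IH]; rewrite ?twist1 // !exprS twistM IH. Qed.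

Lemma twist_sum (T : Type) (s : seq T) (P : pred T) (g : T -> exterior F m) :
  twist (\sum_(i <- s | P i) g i) = \sum_(i <- s | P i) twist (g i).
Proof. exact: (big_morph _ twistD twist0). Qed.

Lemma twist_homogeneous p a : homogeneous p a ->
  twist a = t ^+ p *: ([ffun K : {set 'I_m} => f (a K)] : form G m).
Proof.
move=> ha; apply/ffunP => K; rewrite formZE twistE ffunE.
by have [->|/ha->//] := eqVneq (a K) 0; rewrite rmorph0 !mulr0.
Qed.

Lemma twist_supp a K : t != 0 -> (twist a K != 0) = (a K != 0).
Proof. by move=> t0; rewrite twistE mulf_eq0 expf_eq0 (negbTE t0) andbF fmorph_eq0. Qed.

End Twist.

Section Exponential.
Variables (F : numFieldType) (m : nat).
Implicit Types (a b : exterior F m).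

Lemma wedge_powE a j : wedge_pow a j = a ^+ j.
Proof. by elim: j => [|j IH] //=; rewrite exprS -IH. Qed.

(** The j-th power of a 2-form vanishes for j > m, so the series may be cut
    anywhere after that. *)
Lemma wedge_expE a : homogeneous 2 a -> forall M, (m < M)%N ->
  wedge_exp a = \sum_(j < M) (j`!%:R)^-1 *: a ^+ j.
Proof.
move=> ha M ltM; rewrite -(big_mkord predT (fun j => (j`!%:R)^-1 *: a ^+ j)).
rewrite (big_cat_nat (n := m.+1)) //= [X in _ + X]big_nat_cond [X in _ + X]big1 => [|j Hj].
  by rewrite addr0 big_mkord; apply: eq_bigr => j _; rewrite wedge_powE.
rewrite (homogeneous_eq0 (homogeneousX (j := j) ha)) ?scaler0 //; lia.
Qed.

Lemma triangle_sum (V : nmodType) M (g : nat -> nat -> V) :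
  (forall i j, (M <= i + j)%N -> g i j = 0) ->
  \sum_(l < M) \sum_(i < l.+1) g i (l - i)%N = \sum_(i < M) \sum_(j < M) g i j.
Proof.
move=> g0.
transitivity (\sum_(l < M) \sum_(i < M | (i <= l)%N) g i (l - i)%N).
  apply: eq_bigr => l _; rewrite -(big_mkord (fun i => i <= l)%N (fun i => g i (l - i)%N)).
  rewrite (big_cat_nat (n := l.+1)) ?ltn_ord //= [X in _ + X]big_nat_cond [X in _ + X]big1 => [|i Hi]; last by exfalso; lia.
  rewrite addr0 -(big_mkord predT (fun i => g i (l - i)%N)) big_nat_cond [RHS]big_nat_cond.
  by apply: eq_bigl => i /=; rewrite ltnS andbT andbb.
rewrite (exchange_big_dep predT) //=; apply: eq_bigr => i _.
rewrite -(big_mkord (fun l => i <= l)%N (fun l => g i (l - i)%N)).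
rewrite (big_cat_nat (n := i)) ?(ltnW (ltn_ord i)) //= big_nat_cond big1 ?add0r =>
  [|l Hl]; last by exfalso; lia.
rewrite -(big_mkord predT (g i)) [RHS](big_cat_nat (n := (M - i)%N)) ?leq_subr //=.
rewrite [X in _ = _ + X]big_nat_cond [X in _ = _ + X]big1 => [|j Hj]; last by apply: g0;
  lia.
rewrite addr0 -{1}[i : nat]add0n big_addn big_nat_cond [RHS]big_nat_cond.
by apply: eq_big => [j|j _] /=; [rewrite leq_addl | rewrite addnK].
Qed.

(** The binomial formula, where both series are cut at 2m so that the triangle
    i + j <= 2m contains every product of nonzero powers. *)
Lemma wedge_expD a b : homogeneous 2 a -> homogeneous 2 b ->
  (wedge_exp (a + b) : exterior F m) = (wedge_exp a : exterior F m) * wedge_exp b.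
Proof.
move=> ha hb; have hab := homogeneousD ha hb.
pose M := m.*2.+1; have ltM : (m < M)%N by rewrite /M; lia.
rewrite !(wedge_expE _ ltM) //.
pose g i j := (i`!%:R)^-1 *: a ^+ i * ((j`!%:R)^-1 *: b ^+ j).
rewrite big_distrl; under [RHS]eq_bigr do rewrite big_distrr.
rewrite /= -(triangle_sum (g := g)) => [|i j leM]; last first.
  rewrite /g -scalerAl -scalerAr.
  rewrite (homogeneous_eq0 (homogeneousM (homogeneousX (j := i) ha) (homogeneousX (j := j) hb))) ?scaler0 //.
  by rewrite /M in leM; lia.
apply: eq_bigr => l _; rewrite addrC exprDn_comm; last exact: (even_comm a hb).
rewrite scaler_sumr; apply: eq_bigr => i _.
have le_il : (i <= l)%N by rewrite -ltnS.
rewrite /g -scalerAl -scalerAr scalerA -scaler_nat scalerA.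
rewrite (commrX _ (commr_sym (commrX _ (even_comm b ha _)))) //; congr (_ *: _).
rewrite -(bin_fact le_il) !natrM.
have nz k : k`!%:R != 0 :> F by rewrite Num.Theory.pnatr_eq0 -lt0n fact_gt0.
have nzC : 'C(l, i)%:R != 0 :> F by rewrite Num.Theory.pnatr_eq0 -lt0n bin_gt0.
by field; rewrite !nz nzC.
Qed.

Lemma wedge_exp_twist (f : {rmorphism F -> F}) t a :
  twist f t (wedge_exp a) = wedge_exp (twist f t a).
Proof.
rewrite /wedge_exp twist_sum; apply: eq_bigr => j _.
by rewrite !wedge_powE -twistX twistZ fmorphV rmorph_nat.
Qed.

End Exponential.

Section ExponentialMore.
Variables (F : numFieldType) (m : nat).
Implicit Types (a b : exterior F m).

Lemma wedge_exp_comm a b : homogeneous 2 a -> GRing.comm (wedge_exp a : exterior F m) b.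
Proof.
move=> ha; rewrite /GRing.comm /wedge_exp big_distrl big_distrr /=.
apply: eq_bigr => j _; rewrite wedge_powE -scalerAl -scalerAr; congr (_ *: _).
by apply/commr_sym/commrX/commr_sym/(even_comm _ ha).
Qed.

Lemma wedge_exp_set0 a : homogeneous 2 a -> wedge_exp a set0 = 1.
Proof.
move=> ha; rewrite sum_ffunE big_ord_recl big1 ?addr0 => [|j _].
  by rewrite formZE fact0 invr1 mul1r monoE eqxx.
rewrite formZE wedge_powE; apply/eqP; rewrite mulf_eq0 orbC.
by have [//|/(homogeneousX ha)] := eqVneq ((a ^+ lift ord0 j) set0) 0; rewrite cards0.
Qed.

Lemma form_supp (a : form F m) : a <> 0 -> exists K, a K != 0.
Proof.
move=> nz; case: (pickP [pred K | a K != 0]) => [K aK|z]; first by exists K.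
by case: nz; apply/ffunP => K; rewrite ffunE; apply/eqP; have /negbFE := z K.
Qed.

(** Exponentials of 2-forms are even, hence central. *)
Lemma wedge_expM a b (O P : exterior F m) : homogeneous 2 a -> homogeneous 2 b ->
  wedge (wedge (wedge_exp a) O) (wedge (wedge_exp b) P) =
  wedge (wedge_exp (a + b)) (wedge O P).
Proof.
move=> ha hb; rewrite (wedge_expD ha hb).
change ((wedge_exp a : exterior F m) * O * ((wedge_exp b : exterior F m) * P) =
  (wedge_exp a : exterior F m) * (wedge_exp b : exterior F m) * (O * P)).
by rewrite -!mulrA (mulrA O) -(wedge_exp_comm O hb) -!mulrA.
Qed.

Lemma wedgeZrr (x : F) a b (d : exterior F m) :
  wedge a (wedge b (x *: d)) = x *: wedge a (wedge b d).
Proof. by rewrite -!wedgeZr. Qed.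

(** Degrees leave only one term of the exponential series. *)
Lemma wedge_exp_coef (x : F) a (b : exterior F m) p q (K : {set 'I_m}) : homogeneous 2 a ->
  homogeneous q b -> (2 * p + q)%N = #|K| ->
  wedge (wedge_exp (x *: a)) b K = (p`!%:R)^-1 * x ^+ p * wedge (a ^+ p) b K.
Proof.
move=> ha hb cK.
have ltpm : (p < m.+1)%N by have := max_card (mem K); rewrite card_ord -cK; lia.
have -> : wedge (wedge_exp (x *: a)) b =
    \sum_(j < m.+1) ((j`!%:R)^-1 * x ^+ j) *: wedge (a ^+ j) b.
  rewrite wedge_suml; apply: eq_bigr => j _.
  by rewrite wedge_powE exprZn scalerA wedgeZl.
rewrite sum_ffunE (bigD1 (Ordinal ltpm)) //= big1 => [|j njp].
  by rewrite addr0 formZE.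
apply/eqP; rewrite formZE mulf_eq0; apply/orP; right; apply: contraR njp => nz.
have := homogeneousM (homogeneousX (j := j) ha) hb nz.
by rewrite -cK => e; apply/eqP/val_inj => /=; lia.
Qed.

End ExponentialMore.


(** * Supports of pure spinors *)

Section Toggle.
Variable m : nat.
Implicit Types (i p q : 'I_m) (I K : {set 'I_m}).

(** The effect on the monomial e^K of either Clifford generator with index i that
    does not kill it. *)
Definition toggle i K := if i \in K then K :\ i else i |: K.

Lemma in_toggle p q K : (p \in toggle q K) = (p == q) (+) (p \in K).
Proof.
rewrite /toggle; case: ifP => qK; rewrite !inE; last by have [->|] := eqVneq p q;
  rewrite ?qK.
by have [->|] := eqVneq p q; rewrite ?qK.
Qed.

Lemma toggleK p : involutive (toggle p).
Proof. by move=> K; apply/setP => i; rewrite !in_toggle addbA addbb. Qed.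

Lemma toggleC p q K : toggle p (toggle q K) = toggle q (toggle p K).
Proof. by apply/setP => i; rewrite !in_toggle addbCA. Qed.

Definition symdiff I K := [set i | (i \in I) (+) (i \in K)].

Lemma symdiff_toggle p I K : symdiff I (toggle p K) = toggle p (symdiff I K).
Proof. by apply/setP => i; rewrite !(inE, in_toggle) addbCA. Qed.

Lemma symdiffC I K : symdiff I K = symdiff K I.
Proof. by apply/setP => i; rewrite !inE addbC. Qed.

Lemma symdiff_eq0 I K : symdiff I K = set0 -> I = K.
Proof. by move=> h; apply/setP => i; have /setP/(_ i) := h; rewrite !inE;
  do 2!case: (_ \in _). Qed.

End Toggle.

Section Clifford.
Variables (F : fieldType) (m : nat).
Implicit Types (u : 'cV[F]_(m + m)) (rho sigma : form F m) (K : {set 'I_m}).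

Lemma wedge_covec (xi : 'cV[F]_m) rho K : wedge (covec xi) rho K =
  \sum_(i in K) (-1) ^+ #|[set j in K | (j < i)%N]| * xi i 0 * rho (K :\ i).
Proof.
rewrite /covec wedge_suml sum_ffunE [RHS]big_mkcond; apply: eq_bigr => i _.
rewrite -wedgeZl formZE wedgeE.
case: ifP => iK; last first.
  rewrite big1 ?mulr0 // => I sIK; rewrite monoE; case: eqP => [eI|_];
    last by rewrite mulr0 mul0r.
  by move: sIK; rewrite eI sub1set iK.
rewrite (bigD1 [set i]) ?sub1set //= big1 => [|I /andP[_ /negbTE nI]];
  last by rewrite monoE nI mulr0 mul0r.
rewrite addr0 monoE eqxx mulr1 inversions1l mulrCA mulrA; congr (_ ^+ _ * _ * _).
by apply: eq_card => j; rewrite !inE; case: eqP => [->|]; rewrite ?ltnn ?andbF.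
Qed.

(** In the coefficient at K of u . rho, the index i contributes through the leg
    leg (i \in K) u i; see cliffordE. *)
Definition leg (b : bool) u (i : 'I_m) : F :=
  if b then u (rshift m i) 0 else u (lshift m i) 0.

(** Interior and exterior products by the i-th basis vectors both read off the
    coefficient at K with i toggled, with the same sign. *)
Lemma cliffordE u rho K : clifford u rho K =
  \sum_(i < m) (-1) ^+ #|[set j in K | (j < i)%N]| * leg (i \in K) u i * rho (toggle i K).
Proof.
rewrite /clifford formDE wedge_covec ffunE addrC [RHS](bigID (mem K)) /=.
congr (_ + _); apply: eq_bigr => i.
  by move=> iK; rewrite /leg /toggle iK !mxE.
by move=> /negbTE iK; rewrite /leg /toggle iK !mxE.
Qed.

Section Support.
Variables (rho : form F m) (K : {set 'I_m}).
Hypothesis rhoK : rho K != 0.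

(** The coefficient of u . rho at K with q toggled only sees the leg of u
    that toggles q in K, as all the other legs involved vanish. *)
Lemma annihilator_leg_inj u : clifford u rho = 0 ->
  (forall q, leg (q \in K) u q = 0) -> u = 0.
Proof.
move=> urho leg0.
have leg1 q : leg (q \notin K) u q = 0.
  have /ffunP/(_ (toggle q K)) := urho.
  rewrite cliffordE [RHS]ffunE (bigD1 q) //= big1 => [|i /negbTE niq]; last first.
    by rewrite in_toggle niq leg0 mulr0 mul0r.
  rewrite addr0 toggleK in_toggle eqxx /= => /eqP.
  by rewrite !mulf_eq0 signr_eq0 (negbTE rhoK) orbF => /eqP.
apply/matrixP => i j; rewrite ord1 mxE -(splitK i).
case: (split i) => q; rewrite /=.
  by case: (boolP (q \in K)) (leg0 q) (leg1 q) => _; rewrite /leg.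
by case: (boolP (q \in K)) (leg0 q) (leg1 q) => _; rewrite /leg.
Qed.

(** Being Lagrangian, the annihilator of rho is the graph of a map from the
    legs that kill e^K to the legs that toggle an element of K. *)
Hypothesis graph : forall p, exists2 u, clifford u rho = 0 &
  forall q, leg (q \in K) u q = (q == p)%:R.

(** In the coefficient of u . sigma at K' with p toggled, the index p contributes
    the nonzero term sigma K', so another index must contribute too; where K and
    K' agree the legs of u involved vanish. *)
Lemma annihilator_step u p K' sigma : clifford u sigma = 0 ->
  (forall q, leg (q \in K) u q = (q == p)%:R) ->
  p \in symdiff K K' -> sigma K' != 0 ->
  exists q, [/\ q != p, q \in symdiff K K', leg (q \notin K) u q != 0
    & sigma (toggle q (toggle p K')) != 0].
Proof.
move=> usigma legu pKK' sK'.
case: (pickP [pred q | [&& q != p, q \in symdiff K K', leg (q \notin K) u q != 0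
    & sigma (toggle q (toggle p K')) != 0]]) => [q /and4P[*]|none].
  by exists q.
have /ffunP/(_ (toggle p K')) := usigma.
rewrite cliffordE [RHS]ffunE (bigD1 p) //= big1 => [|q nqp]; last first.
  rewrite in_toggle (negbTE nqp) /=.
  have := none q; rewrite /= nqp inE /=.
  have [eqK|neqK] := eqVneq (q \in K) (q \in K').
    by rewrite -eqK legu (negbTE nqp) mulr0 mul0r.
  have -> : (q \in K') = (q \notin K) by move: neqK; do 2!case: (q \in _).
  have -> : (q \in K) (+) (q \notin K) by case: (q \in K).
  have [->|_ /=] := eqVneq (leg (q \notin K) u q) 0; first by rewrite mulr0 mul0r.
  by move=> /negbFE/eqP->; rewrite mulr0.
rewrite addr0 toggleK in_toggle eqxx /= => /eqP.
have -> : (p \notin K') = (p \in K) by move: pKK'; rewrite inE; do 2!case: (p \in _).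
by rewrite legu eqxx mulr1 mulf_eq0 signr_eq0 (negbTE sK').
Qed.

(** The index q supplied by annihilator_step works because the coefficient of
    u . rho at K with q toggled has only two terms, those of p and q. *)
Lemma spinor_exchange K' p : rho K' != 0 -> p \in symdiff K K' ->
  exists q, [/\ q != p, q \in symdiff K K' & rho (toggle q (toggle p K)) != 0].
Proof.
move=> rK' pKK'; have [u urho legu] := graph p.
have [q [nqp qKK' legq _]] := annihilator_step urho legu pKK' rK'.
exists q; split=> //; apply/eqP => rq0; rewrite toggleC in rq0.
have /ffunP/(_ (toggle q K)) := urho.
rewrite cliffordE [RHS]ffunE (bigD1 q) //= big1 => [|i niq]; last first.
  rewrite in_toggle (negbTE niq) legu.
  by have [->|] := eqVneq i p; rewrite ?rq0 mulr0 ?mul0r.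
rewrite addr0 toggleK in_toggle eqxx /= => /eqP.
by rewrite !mulf_eq0 signr_eq0 (negbTE legq) (negbTE rhoK).
Qed.

(** Each coefficient of a form annihilated by L is a combination of
    coefficients at sets closer to K, so the line of pure spinors of L is
    determined by the coefficient at K. *)
Lemma pure_spinor_unique sigma :
  (forall u, clifford u rho = 0 -> clifford u sigma = 0) ->
  sigma K = 0 -> sigma = 0.
Proof.
move=> Lsigma sK; apply/ffunP => K'; rewrite ffunE; apply/eqP/negbNE.
have [d] := ubnP #|symdiff K K'|; elim: d K' => // d IH K' ltd.
apply/negP => sK'; have [e0|[p pKK']] := set_0Vmem (symdiff K K').
  by move: sK'; rewrite -(symdiff_eq0 e0) sK eqxx.
have [u urho legu] := graph p.
have [q [nqp qKK' _]] := annihilator_step (Lsigma _ urho) legu pKK' sK'.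
apply/negP; apply: IH; rewrite !symdiff_toggle.
have qp : q \in toggle p (symdiff K K') by rewrite in_toggle (negbTE nqp).
move: ltd; rewrite (cardsD1 p) pKK' [toggle q _]/toggle qp.
rewrite /toggle pKK' => ltd; rewrite (leq_ltn_trans (subset_leq_card (subD1set _ _))) //.
Qed.

End Support.
End Clifford.

(** * The eigenspace as a graph *)

Section Eigenspace.
Variables (R : realType) (m : nat) (J : 'M[R]_(m + m)).
Hypothesis J2 : J *m J = - 1%:M.
Let D : 'M[R[i]]_(m + m) := cplx_mx J - ('i)%C%:M.

Lemma i_eigenP u : i_eigen J u <-> D *m u = 0.
Proof.
rewrite /i_eigen mulmxBl mul_scalar_mx.
by split=> [->|/eqP]; rewrite ?subrr // subr_eq0 => /eqP.
Qed.

(** The two eigenspaces of J are conjugate, hence both half-dimensional. *)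
Lemma i_eigen_rank : \rank D = m.
Proof.
have ii : ('i : R[i])%C * ('i)%C = -1 by rewrite -expr2 sqr_i.
have D2 : cplx_mx J *m cplx_mx J = - 1%:M.
  by rewrite /cplx_mx -map_mxM J2 map_mxN map_mx1.
have conjD : map_mx (@conjc R) D = cplx_mx J + ('i)%C%:M.
  rewrite /D map_mxB; congr (_ + _).
    by apply/matrixP => i j; rewrite !mxE; exact: conjc_real.
  by rewrite map_scalar_mx -raddfN; congr (_%:M); apply/eqP;
     rewrite eq_complex /= !oppr0 opprK !eqxx.
have rk : \rank (map_mx (@conjc R) D) = \rank D by rewrite mxrank_map.
have prod0 : D *m map_mx (@conjc R) D = 0.
  rewrite conjD /D mulmxBl !mulmxDr D2 mul_mx_scalar !mul_scalar_mx.
  by rewrite -[('i)%C%:M]scalemx1 scalerA ii scaleN1r opprD opprK addrA addrK addNr.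
have nzi : ('i : R[i])%C *+ 2 != 0.
  by rewrite -mulr_natr mulf_neq0 ?Num.Theory.pnatr_eq0 // -sqrf_eq0 sqr_i oppr_eq0 oner_eq0.
have le1 : (\rank D + \rank D <= m + m)%N by rewrite -{2}rk mulmx0_rank_max.
have le2 : (m + m <= \rank D + \rank D)%N.
  rewrite -{2}rk -[\rank D](mxrank_opp D).
  apply: leq_trans (mxrank_add _ _).
  rewrite [X in \rank X](_ : _ = ('i *+ 2)%C *: 1%:M) ?mxrank_scale_nz ?mxrank1 //.
  rewrite conjD /D opprB scalemx1 mulr2n raddfD /=; set a := cplx_mx J.
  by rewrite [a + _]addrC addrACA addNr addr0.
by lia.
Qed.

(** By half-dimensionality, an injective projection of L on the m legs in
    question is surjective. *)
Lemma i_eigen_graph (K : {set 'I_m}) :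
  (forall u, i_eigen J u -> (forall q, leg (q \in K) u q = 0) -> u = 0) ->
  forall p, exists2 u, i_eigen J u & forall q, leg (q \in K) u q = (q == p)%:R.
Proof.
move=> inj p.
pose S : 'M[R[i]]_(m + m, m) :=
  \matrix_(i, q) (i == if q \in K then rshift m q else lshift m q)%:R.
pose M := kermx D^T.
have legS (v : 'rV_(m + m)) q : (v *m S) 0 q = leg (q \in K) v^T q.
  rewrite mxE /leg /S; pose t := if q \in K then rshift m q else lshift m q.
  rewrite (bigD1 t) //= big1 => [|j /negbTE njt]; last by rewrite mxE njt mulr0.
  rewrite addr0 [X in _ * X]mxE eqxx mulr1 /t.
  by case: (q \in K); rewrite mxE.
have eigM (v : 'rV_(m + m)) : (v <= M)%MS -> i_eigen J v^T.
  move=> /sub_kermxP vD; apply/i_eigenP; apply: trmx_inj.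
  by rewrite trmx_mul trmxK vD trmx0.
have capM : (M :&: kermx S)%MS = 0.
  apply/eqP; rewrite -submx0; apply/rV_subP => v.
  rewrite sub_capmx => /andP[/eigM eigv /sub_kermxP vS].
  suff /(congr1 trmx) : v^T = 0 by rewrite trmxK trmx0 => ->; rewrite sub0mx.
  by apply: inj => // q; rewrite -legS vS mxE.
have fullMS : row_full (M *m S).
  rewrite /row_full -[X in _ == X]i_eigen_rank.
  have := mxrank_mul_ker M S; rewrite capM mxrank0 addn0 => ->.
  by rewrite mxrank_ker mxrank_tr i_eigen_rank addnK.
have /submxP[w dw] := submx_full (delta_mx 0 p : 'rV_m) fullMS.
exists (w *m M)^T; first by apply: eigM; apply: submxMl.
by move=> q; rewrite -legS -mulmxA -dw mxE eqxx.
Qed.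

End Eigenspace.

(** * Spinors of type k *)

Section Complexification.
Variables (R : realType) (m : nat).
Notation C := (R[i]).

Lemma cplx_form_homogeneous p (a : form R m) :
  homogeneous p a -> homogeneous p (cplx_form a).
Proof.
move=> ha K; rewrite ffunE => nz; apply: ha; apply: contraNneq nz => ->.
by rewrite rmorph0.
Qed.

Lemma conj_form_homogeneous p (a : form C m) :
  homogeneous p a -> homogeneous p (conj_form a).
Proof. by move=> ha K; rewrite ffunE conjc_eq0 => /ha. Qed.

Lemma twist_conj_complex (B w : form R m) : homogeneous 2 B -> homogeneous 2 w ->
  twist (@conjc R) 'i%C (cplx_form B + 'i%C *: cplx_form w) =
  - cplx_form B + 'i%C *: cplx_form w.
Proof.
move=> hB hw; rewrite (@twist_homogeneous _ _ _ _ _ 2); last first.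
  by apply: homogeneousD; [|apply: homogeneousZ]; apply: cplx_form_homogeneous.
apply/ffunP => K; rewrite sqr_i formZE ffunE !(formDE, formZE) !ffunE.
by rewrite mulN1r; apply/eqP; rewrite eq_complex /=; apply/andP; split; apply/eqP; ring.
Qed.

Lemma cplx_formE (a : form R m) : cplx_form a = twist (real_complex R) 1 a.
Proof. by apply/ffunP => K; rewrite twistE ffunE expr1n mul1r. Qed.

Lemma conj_formE (a : form C m) : conj_form a = twist (@conjc R) 1 a.
Proof. by apply/ffunP => K; rewrite twistE ffunE expr1n mul1r. Qed.

Lemma cplx_mono (I : {set 'I_m}) : cplx_form (mono R I) = mono C I.
Proof. by apply/ffunP => K; rewrite !ffunE rmorph_nat. Qed.

Lemma conj_mono (I : {set 'I_m}) : conj_form (mono C I) = mono C I.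
Proof. by apply/ffunP => K; rewrite !ffunE conjc_nat. Qed.

Lemma cplx_diag (A : 'M[R]_m) : is_diag_mx A -> is_diag_mx (cplx_mx A).
Proof.
move=> A_diag; apply/is_diag_mxP => i j nij; rewrite mxE.
by have /is_diag_mxP/(_ i j nij) -> := A_diag; rewrite rmorph0.
Qed.

Lemma cplx_weight (W : 'I_m -> R) K :
  weight (fun i => real_complex R (W i)) K = real_complex R (weight W K).
Proof. by rewrite /weight rmorph_sum. Qed.

End Complexification.

Section SpinorType.
Variables (R : realType) (n k m : nat) (rho : form R[i] m).
Hypotheses (def_m : m = n.*2) (le_kn : (k <= n)%N) (type_rho : spinor_of_type n k rho).
Notation C := (R[i]).

(** The first fact and the size of I hold because exp(b) starts with 1, so that
    Omega is the lowest part of rho. As Omega /\ conj Omega <> 0, two disjoint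
    monomials occur in Omega, and one of them avoids i0. The last fact is the
    Mukai pairing of rho with conj rho: multiplied by the conjugate twisted by
    t = i, rho becomes exp(2 i w) /\ Omega /\ conj Omega up to a power of i, and
    its top coefficient is a nonzero multiple of that of
    w^(n-k) /\ Omega /\ conj Omega. *)
Lemma spinor_of_type_facts :
  [/\ forall K, rho K != 0 -> (k <= #|K|)%N,
      forall i0 : 'I_m, exists I : {set 'I_m}, [/\ i0 \notin I, rho I != 0 & #|I| = k]
    & exists2 K : {set 'I_m}, rho K != 0 & rho (~: K) != 0].
Proof.
have [B [w [c [theta []]]]] := type_rho; set b := cplx_form B + _; set Omega := c *: _.
move=> [hB hw] _ def_rho nondeg.
have hb : homogeneous 2 b.
  by apply: homogeneousD; [|apply: homogeneousZ]; apply: cplx_form_homogeneous.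
have hO : homogeneous k Omega.
  by apply: homogeneousZ; have := homogeneous_prod_covec (s := theta); rewrite size_tuple.
have hOO : homogeneous k (conj_form Omega) by apply: conj_form_homogeneous.
have rhoO (I : {set 'I_m}) : #|I| = k -> rho I = Omega I.
  move=> cI; rewrite def_rho [wedge _ _ I]wedgeE (bigD1 set0) ?sub0set //= big1 =>
    [|I' /andP[sI nI]].
    by rewrite inversions0l wedge_exp_set0 // setD0 !mul1r addr0.
  have [->|/hO] := eqVneq (Omega (I :\: I')) 0; first by rewrite mulr0.
  rewrite cardsD (setIidPr sI) cI => ek.
  have : (0 < #|I'|)%N by rewrite card_gt0.
  by have := subset_leq_card sI; rewrite cI; lia.
split.
- move=> K; rewrite def_rho => /wedge_supp[I [_ _ /hO <-]].
  by rewrite subset_leq_card ?subsetDl.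
- move=> i0.
  have /form_supp[K /wedge_supp[I [sIK OI]]] : wedge Omega (conj_form Omega) <> 0.
    by move=> z; apply: nondeg; rewrite z; exact: (mulr0 (_ : exterior C m)).
  rewrite ffunE conjc_eq0 => OKI.
  case: (boolP (i0 \in I)) => i0I; [exists (K :\: I) | exists I].
    by rewrite inE i0I /= rhoO (hO _ OKI).
  by rewrite rhoO ?(hO _ OI).
pose sigma := twist (@conjc R) 'i%C rho.
have i0 : 'i%C != 0 :> C by rewrite -sqrf_eq0 sqr_i oppr_eq0 oner_eq0.
suff /wedge_supp[I [_ rI]] : wedge rho sigma setT != 0.
  by rewrite twist_supp // setTD; exists I.
have -> : sigma = wedge (wedge_exp (- cplx_form B + 'i%C *: cplx_form w)) ('i%C ^+ k *: conj_form Omega).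
  rewrite /sigma def_rho [LHS]twistM; congr (wedge _ _).
    by rewrite wedge_exp_twist twist_conj_complex.
  by rewrite (twist_homogeneous _ _ hO); congr (_ *: _); apply/ffunP => K; rewrite !ffunE.
set b' := - _ + _.
have hb' : homogeneous 2 b'.
  apply: homogeneousD; last by apply: homogeneousZ; apply: cplx_form_homogeneous.
  by rewrite -scaleN1r; apply: homogeneousZ; apply: cplx_form_homogeneous.
rewrite def_rho (wedge_expM _ _ hb hb').
have -> : b + b' = ('i%C *+ 2) *: cplx_form w.
  by rewrite /b /b' addrACA subrr add0r mulr2n scalerDl.
have hX : homogeneous (k + k) (wedge Omega ('i%C ^+ k *: conj_form Omega)).
  by apply: homogeneousM => //; apply: homogeneousZ.
have hw' := cplx_form_homogeneous hw.
rewrite (wedge_exp_coef (p := (n - k)%N) _ hw' hX); last first.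
  by rewrite cardsT card_ord def_m; lia.
rewrite wedgeZrr formZE !mulf_neq0 ?invr_eq0 ?expf_neq0 //.
- by rewrite Num.Theory.pnatr_eq0 -lt0n fact_gt0.
- by rewrite -mulr_natr mulf_neq0 // Num.Theory.pnatr_eq0.
apply: homogeneous_top; last by rewrite -wedge_powE.
have := homogeneousM (homogeneousX (j := (n - k)%N) hw') (homogeneousM hO hOO).
by rewrite (_ : _ + _ = m)%N //; rewrite [RHS]def_m; lia.
Qed.

End SpinorType.

(** * From exchanges to spectra *)

Section Lists.
Variable R : realType.
Implicit Types (s t : seq R) (x y : R).

Lemma doubled_cons x s : doubled (x :: s) = [:: x, x & doubled s].
Proof. by []. Qed.

Lemma with_opposites_cons x s :
  with_opposites (x :: s) = [:: x, - x & with_opposites s].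
Proof. by []. Qed.

Lemma with_opposites_cat s t :
  with_opposites (s ++ t) = with_opposites s ++ with_opposites t.
Proof. by rewrite /with_opposites map_cat flatten_cat. Qed.

Lemma size_doubled s : size (doubled s) = (size s).*2.
Proof. by elim: s => //= x s ->. Qed.

Lemma size_with_opposites s : size (with_opposites s) = (size s).*2.
Proof. by elim: s => //= x s ->. Qed.

Lemma doubled_cat_perm s : perm_eq (doubled s) (s ++ s).
Proof.
elim: s => //= x s IH; rewrite perm_cons.
by rewrite perm_sym perm_catC /= perm_cons perm_sym.
Qed.

Lemma perm_flatten_map (f : R -> seq R) s t :
  perm_eq s t -> perm_eq (flatten (map f s)) (flatten (map f t)).
Proof. by move=> st; apply: perm_flatten; apply: perm_map. Qed.

Lemma perm_doubled s t : perm_eq s t -> perm_eq (doubled s) (doubled t).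
Proof. exact: perm_flatten_map. Qed.

Lemma perm_with_opposites s t :
  perm_eq s t -> perm_eq (with_opposites s) (with_opposites t).
Proof. exact: perm_flatten_map. Qed.

Lemma mem_doubled x s : (x \in doubled s) = (x \in s).
Proof. by rewrite (perm_mem (doubled_cat_perm s)) mem_cat orbb. Qed.

Lemma mem_with_opposites x s :
  x \in with_opposites s -> exists2 y, y \in s & x = y \/ x = - y.
Proof.
case/flatten_mapP => y ys; rewrite !inE => /orP[]/eqP->; exists y => //; first by left.
by right.
Qed.

Lemma perm_cons_cat x s t : perm_eq (s ++ x :: t) (x :: s ++ t).
Proof. by rewrite -cat1s perm_catCA. Qed.

(** Here w0 stands for a weight given to e_0: the two shapes of the spectrum are
    the two places where it can be removed from the list, a doubled weight
    leaving its twin mu = w0, a pair of opposites leaving mu = - w0. *)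
Lemma spectrum_shapes (n k : nat) (E : seq R) : (0 < n)%N -> (k <= n)%N ->
  (exists w0 lam zet, [/\ size lam = k, size zet = (n - k)%N,
     \sum_(l <- lam) l = 0 &
     perm_eq (w0 :: E) (doubled lam ++ with_opposites zet)])
  <->
  ((k <= n - 1)%N /\
   exists (lam : k.-tuple R) (mu : R) (zet : (n - k - 1).-tuple R),
     perm_eq E (doubled lam ++ mu :: with_opposites zet) /\
     \sum_(l <- lam) l = 0)
  \/
  ((1 <= k)%N /\
   exists (lam : (k - 1).-tuple R) (mu : R) (zet : (n - k).-tuple R),
     perm_eq E (doubled lam ++ mu :: with_opposites zet) /\
     mu + \sum_(l <- lam) l = 0).
Proof.
move=> n_gt0 le_kn; split.
  move=> [w0 [lam [zet [szl szz suml Ew]]]].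
  have : w0 \in doubled lam ++ with_opposites zet.
    by rewrite -(perm_mem Ew) mem_head.
  rewrite mem_cat mem_doubled => /orP[w0l|/mem_with_opposites[z zz w0z]].
    right; have pl := perm_to_rem w0l.
    have szl' : size (rem w0 lam) == (k - 1)%N.
      by apply/eqP; have := perm_size pl; rewrite /= szl; lia.
    split; first by rewrite -szl (perm_size pl).
    have szz' : size zet == (n - k)%N by apply/eqP.
    exists (Tuple szl'), w0, (Tuple szz'); split; last first.
      by move: suml; rewrite (perm_big _ pl) big_cons.
    rewrite -(perm_cons w0) (permPl Ew) /= -cat_cons.
    apply: perm_trans (perm_cat (perm_doubled pl) (perm_refl _)) _.
    by rewrite doubled_cons /= perm_cons perm_sym perm_cons_cat.
  left; have pz := perm_to_rem zz.
  have szz' : size (rem z zet) == (n - k - 1)%N.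
    by apply/eqP; have := perm_size pz; rewrite /= szz; lia.
  have szl' : size lam == k by apply/eqP.
  split; first by have := perm_size pz; rewrite szz /=; lia.
  exists (Tuple szl'), (- w0), (Tuple szz'); split=> //=.
  rewrite -(perm_cons w0) (permPl Ew).
  apply: perm_trans (perm_cat (perm_refl _) (perm_with_opposites pz)) _.
  rewrite with_opposites_cons.
  case: w0z => ->; rewrite ?opprK; first exact: perm_cons_cat.
  by apply/permP => P; rewrite /= !count_cat /=; lia.
case=> [[le_k [lam [mu [zet [Ep suml]]]]]|[le_k [lam [mu [zet [Ep suml]]]]]].
  exists (- mu), lam, (mu :: zet); split; rewrite ?size_tuple //=.
    by lia.
  move: Ep; rewrite -(perm_cons (- mu)) => /perm_trans; apply.
  by apply/permP => P; rewrite with_opposites_cons /= !count_cat /=; lia.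
exists mu, (mu :: lam), zet; split; rewrite ?size_tuple //.
- by lia.
- by rewrite big_cons.
move: Ep; rewrite -(perm_cons mu) => /perm_trans; apply.
by apply/permP => P; rewrite doubled_cons /= !count_cat /=; lia.
Qed.

End Lists.

Section Walk.
Variables (R : realType) (m : nat) (W : 'I_m -> R).
Implicit Types (K : {set 'I_m}).

Definition weights K := [seq W i | i <- enum K].

Lemma perm_weightsD1 p K : p \in K -> perm_eq (weights K) (W p :: weights (K :\ p)).
Proof.
move=> pK; rewrite /weights -[W p :: _]/(map W (p :: enum (K :\ p))).
apply: perm_map; apply: uniq_perm; rewrite /= ?enum_uniq ?andbT //.
  by rewrite mem_enum !inE eqxx.
by move=> i; rewrite inE !mem_enum !inE; have [->|] := eqVneq i p.
Qed.

Lemma perm_weightsU1 p K : p \notin K -> perm_eq (weights (p |: K)) (W p :: weights K).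
Proof. by move=> pK; have := perm_weightsD1 (setU11 p K); rewrite setU1K. Qed.

Lemma weight_sumE K : weight W K = \sum_(x <- weights K) x.
Proof. by rewrite big_map big_enum. Qed.

Variables (supp : {set 'I_m} -> bool) (o : 'I_m) (I0 : {set 'I_m}).
Hypothesis exchange : forall K K' p, supp K -> supp K' -> p \in symdiff K K' ->
  exists q, [/\ q != p, q \in symdiff K K' & supp (toggle q (toggle p K))].
Hypothesis weight0 : forall K, o \notin K -> supp K -> weight W K = 0.
Hypotheses (suppI0 : supp I0) (oI0 : o \notin I0).
Hypothesis minI0 : forall K, supp K -> (#|I0| <= #|K|)%N.

(** An exchange that starts from an element of K outside I0 either discards two
    elements of K or replaces one by an element of I0. Both sets avoid o and have
    weight zero, so two discarded weights are opposite and a replaced weight is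
    unchanged. Since I0 has minimal size, the walk can only stop at I0. *)
Lemma exchange_walk K : supp K -> o \notin K ->
  exists zet, perm_eq (weights K) (weights I0 ++ with_opposites zet).
Proof.
have [d] := ubnP #|symdiff K I0|; elim: d K => // d IH K ltd sK oK.
have [sKI0|/subsetPn[p pK pI0]] := boolP (K \subset I0).
  have -> : K = I0 by apply/eqP; rewrite eqEcard sKI0 minI0.
  by exists [::]; rewrite cats0.
have pKI0 : p \in symdiff K I0 by rewrite inE pK (negbTE pI0).
have [q [nqp qKI0 sK1]] := exchange sK suppI0 pKI0.
pose K1 := toggle q (toggle p K).
have nqo : q != o by apply: contraTneq qKI0 => ->; rewrite inE (negbTE oK) (negbTE oI0).
have oK1 : o \notin K1.
  rewrite !in_toggle ![o == _]eq_sym (negbTE nqo) (negbTE oK) /= addbF.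
  by apply: contraNneq oK => <-.
have [|zet permK1] := IH K1 _ sK1 oK1.
  rewrite (_ : symdiff K1 I0 = toggle q (toggle p (symdiff K I0))); last first.
    by rewrite symdiffC !symdiff_toggle symdiffC.
  move: ltd.
  rewrite (cardsD1 p) pKI0 {2}/toggle pKI0 {1}/toggle.
  rewrite in_setD1 nqp qKI0 => ltd.
  by apply: leq_ltn_trans (subset_leq_card (subD1set _ _)) _.
have wK := weight0 oK sK; have wK1 := weight0 oK1 sK1.
have pw := perm_weightsD1 pK.
move: wK; rewrite weight_sumE (perm_big _ pw) big_cons /= => wK.
have [qK|qK] := boolP (q \in K).
  have eK1 : K1 = (K :\ p) :\ q by rewrite /K1 /toggle pK in_setD1 nqp qK.
  have qw : perm_eq (weights (K :\ p)) (W q :: weights K1).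
    by rewrite eK1; apply: perm_weightsD1; rewrite in_setD1 nqp.
  have eW : W q = - W p.
    move: wK wK1; rewrite weight_sumE (perm_big _ qw) big_cons /= => wK wK1.
    by move: wK; rewrite wK1 addr0 addrC => /eqP; rewrite addr_eq0 => /eqP.
  exists (W p :: zet); rewrite with_opposites_cons -eW.
  move/permP: pw => pw; move/permP: qw => qw; move/permP: permK1 => pK1.
  apply/permP => P; move: (pw P) (qw P) (pK1 P).
  by rewrite /= !count_cat /=; clear; lia.
have eK1 : K1 = q |: (K :\ p) by rewrite /K1 /toggle pK in_setD1 nqp (negbTE qK).
have qw : perm_eq (weights K1) (W q :: weights (K :\ p)).
  by rewrite eK1; apply: perm_weightsU1; rewrite in_setD1 nqp.
have eW : W q = W p.
  move: wK1; rewrite weight_sumE (perm_big _ qw) big_cons /= => wK1.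
  by apply: (addIr (\sum_(x <- weights (K :\ p)) x)); rewrite wK wK1.
exists zet; move/permP: pw => pw; move/permP: qw => qw; move/permP: permK1 => pK1.
by apply/permP => P; move: (pw P) (qw P) (pK1 P); rewrite /= eW !count_cat; clear; lia.
Qed.

(** The exchange that removes o either discards it together with q, as if o had
    weight - W q, or replaces it by q, as if o had weight W q. *)
Lemma exchange_walk_o K : supp K -> o \in K ->
  exists w0 zet, perm_eq (w0 :: weights (K :\ o)) (weights I0 ++ with_opposites zet).
Proof.
move=> sK oK.
have oKI0 : o \in symdiff K I0 by rewrite inE oK (negbTE oI0).
have [q [nqo qKI0 sK1]] := exchange sK suppI0 oKI0.
have oK1 : o \notin toggle q (toggle o K).
  by rewrite !in_toggle eq_sym (negbTE nqo) eqxx oK.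
have [zet] := exchange_walk sK1 oK1.
rewrite {1}/toggle in_toggle (negbTE nqo) /= {1 2}/toggle oK.
case: ifP => qK permK1.
  exists (- W q), (W q :: zet).
  have /perm_weightsD1/permP qw : q \in K :\ o by rewrite in_setD1 nqo.
  move/permP: permK1 => pK1; apply/permP => P; move: (qw P) (pK1 P).
  rewrite with_opposites_cons /= !count_cat /= => -> ->.
  by move: (P _ : nat) (P _ : nat) (count P _) (count P _) => a b c d; lia.
exists (W q), zet; rewrite -(permPr permK1) perm_sym.
by apply: perm_weightsU1; rewrite in_setD1 nqo qK.
Qed.

(** Exactly one of K and its complement contains o; the two sets are walked to I0
    separately. *)
Lemma support_spectrum K : supp K -> supp (~: K) ->
  exists w0 zet, perm_eq (w0 :: weights [set~ o])
    (doubled (weights I0) ++ with_opposites zet).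
Proof.
wlog oK : K / o \in K => [wlogK|] sK sKC.
  have [oK|oK] := boolP (o \in K); first exact: (wlogK K).
  by apply: (wlogK (~: K)); rewrite ?setCK ?inE.
have [w0 [zet1 /permP p1]] := exchange_walk_o sK oK.
have [|zet2 /permP p2] := exchange_walk sKC; first by rewrite inE oK.
have /permP pU : perm_eq (weights [set~ o]) (weights (K :\ o) ++ weights (~: K)).
  rewrite /weights -map_cat; apply: perm_map; apply: uniq_perm; rewrite ?enum_uniq //.
    rewrite cat_uniq !enum_uniq andbT /=; apply/hasPn => i.
    by rewrite !mem_enum !inE => /negbTE->; rewrite andbF.
  move=> i; rewrite mem_cat !mem_enum !inE.
  by have [->|_] := eqVneq i o; rewrite ?oK //= orbN.
exists w0, (zet1 ++ zet2); apply/permP => P.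
have /permP/(_ P) := doubled_cat_perm (weights I0); move: (p1 P) (p2 P) (pU P).
by rewrite with_opposites_cat /= !count_cat; clear; lia.
Qed.

End Walk.

(** * Closed forms on an almost abelian Lie algebra *)

Section Closed.
Variables (F : fieldType) (N : nat) (A : 'M[F]_N) (W : 'I_(1 + N) -> F).
Hypotheses (A_diag : is_diag_mx A) (W_A : forall j, W (rshift 1 j) = A j j).
Local Notation o := (lshift N 0 : 'I_(1 + N)).
Implicit Types (rho : form F (1 + N)) (K : {set 'I_(1 + N)}).

Lemma mul_diag_mx_col (x : 'cV[F]_N) j : (A *m x) j 0 = A j j * x j 0.
Proof.
rewrite mxE (bigD1 j) //= big1 ?addr0 // => l nlj.
by have /is_diag_mxP/(_ j l) -> := A_diag; rewrite ?mul0r // eq_sym.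
Qed.

Lemma aa_bracketE (x y : 'cV[F]_(1 + N)) i :
  aa_bracket A x y i 0 = W i * (x o 0 * y i 0 - y o 0 * x i 0).
Proof.
rewrite /aa_bracket -(splitK i); case: (split i) => j /=.
  by rewrite col_mxEu mxE ord1 mulrC (mulrC (y _ _)) subrr mul0r.
rewrite col_mxEd !mxE.
have e (z : 'cV[F]_(1 + N)) : (\sum_j0 A j j0 * (dsubmx z) j0 0) = A j j * z (rshift 1 j) 0.
  by have := mul_diag_mx_col (dsubmx z) j; rewrite !mxE.
by rewrite !e W_A; ring.
Qed.

Lemma d_basisE (p : 'I_(1 + N)) : d_basis (aa_bracket A) p =
  if p == o then 0 else - W p *: mono F [set o; p].
Proof.
rewrite /d_basis (bigD1 o) //= [X in _ + X]big1 => [|i nio]; last first.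
  apply: big1 => j ltij; rewrite aa_bracketE !mxE.
  have -> : (o == i) = false by rewrite eq_sym (negbTE nio).
  have -> : (o == j) = false by apply/eqP => oj; move: ltij; rewrite -oj.
  by rewrite !mul0r subrr mulr0 oppr0 scale0r.
rewrite addr0.
have [->|npo] := eqVneq p o.
  rewrite big1 // => j ltj; rewrite aa_bracketE !mxE eqxx.
  have -> : (o == j) = false by apply/eqP => oj; move: ltj; rewrite -oj.
  by rewrite mulr0 mul0r subrr mulr0 oppr0 scale0r.
rewrite (bigD1 p) /=; last by rewrite lt0n; apply: contra npo => /eqP e; apply/eqP/val_inj.
rewrite big1 ?addr0 => [|j /andP[ltj njp]].
  by rewrite aa_bracketE !mxE !eqxx [o == p]eq_sym (negbTE npo) /= !(mulr0, mul0r, mulr1, subr0).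
rewrite aa_bracketE !mxE [p == j]eq_sym (negbTE njp) (negbTE npo) /=.
by rewrite !(mulr0, subr0, oppr0) scale0r.
Qed.

(** Since d e^p = - W_p e^0 /\ e^p, and e^p /\ iota_(e_p) is the projection on the
    monomials that contain p. *)
Lemma d_formE rho K : d_form (aa_bracket A) rho K =
  if o \in K then - weight W (K :\ o) * rho (K :\ o) else 0.
Proof.
rewrite /d_form sum_ffunE.
have term p : wedge (d_basis (aa_bracket A) p) (contract (delta_mx p 0) rho) K =
    if (o \in K) && (p \in K :\ o) then - W p * rho (K :\ o) else 0.
  rewrite d_basisE; case: eqVneq => [->|npo].
    by rewrite wedge0l ffunE !inE eqxx andbF.
  rewrite -wedgeZl formZE wedgeE.
  have [sK|nsK] := boolP ([set o; p] \subset K); last first.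
    rewrite big1 ?mulr0 => [|I sIK].
      by case: ifP => // /andP[oK pK]; case/negP: nsK; apply/subsetP => i;
         rewrite !inE => /orP[]/eqP->//; move: pK; rewrite inE => /andP[].
    rewrite monoE; case: eqP => [eI|_]; last by rewrite mulr0 mul0r.
    by rewrite -eI sIK in nsK.
  have oK : o \in K by apply: (subsetP sK); rewrite !inE eqxx.
  have pK : p \in K by apply: (subsetP sK); rewrite !inE eqxx orbT.
  rewrite oK !inE npo pK /= (bigD1 [set o; p]) //= big1 ?addr0; last first.
    by move=> I /andP[_ /negbTE nI]; rewrite monoE nI mulr0 mul0r.
  congr (_ * _); rewrite monoE eqxx mulr1.
  rewrite ffunE (bigD1 p) /=; last by rewrite !inE eqxx orbT.
  rewrite big1 ?addr0 => [|i /andP[_ nip]]; last by rewrite mxE (negbTE nip) mulr0 mul0r.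
  rewrite mxE !eqxx mulr1 inversionsUl ?disjoints1 ?inE ?[o == p]eq_sym //.
  rewrite !inversions1l exprD mulrA.
  rewrite (_ : #|[set j in K :\: [set o; p] | (j < o)%N]| = 0%N); last first.
    by apply: eq_card0 => j; rewrite !inE ltn0 andbF.
  rewrite expr0 mul1r -expr2 sqrr_sign mul1r; congr (rho _).
  apply/setP => j; rewrite !inE; have [->|] := eqVneq j p; rewrite ?npo //=.
  by rewrite orbF.
rewrite (eq_bigr _ (fun p _ => term p)); case: ifP => oK /=; last by rewrite big1.
by rewrite -big_mkcond /= -mulr_suml sumrN.
Qed.

Lemma closedP rho : d_form (aa_bracket A) rho = 0 <->
  forall K, o \notin K -> rho K != 0 -> weight W K = 0.
Proof.
split=> [/ffunP drho K oK nz | h].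
  have := drho (o |: K); rewrite d_formE setU11 setU1K // ffunE => /eqP.
  by rewrite mulf_eq0 (negbTE nz) orbF oppr_eq0 => /eqP.
apply/ffunP => K; rewrite d_formE ffunE; case: ifP => // oK.
have [->|nz] := eqVneq (rho (K :\ o)) 0; first by rewrite mulr0.
by rewrite h ?oppr0 ?mul0r // setD11.
Qed.

End Closed.

(** * Necessity *)

Section Necessity.
Variables (R : realType) (n : nat).
Hypothesis n_gt0 : (0 < n)%N.
Notation N := (n.*2.-1).
Variables (A : 'M[R]_N) (k : nat).
Hypotheses (A_diag : is_diag_mx A) (le_kn : (k <= n)%N).
Local Notation o := (lshift N 0 : 'I_(1 + N)).

Definition diag_entries := [seq A i i | i <- enum 'I_N].

Lemma eigenvalues_listedP s : eigenvalues_listed A s <-> perm_eq diag_entries s.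
Proof.
rewrite /eigenvalues_listed char_poly_trig ?is_diag_mx_is_trig // /diag_entries.
have -> : \prod_(i < N) ('X - (A i i)%:P) =
    \prod_(x <- [seq A i i | i <- enum 'I_N]) ('X - x%:P).
  by rewrite big_map big_enum.
split=> [/prod_XsubC_eq //|]; exact: perm_big.
Qed.

Lemma perm_weights_h (W : 'I_(1 + N) -> R) :
  (forall j, W (rshift 1 j) = A j j) -> perm_eq (weights W [set~ o]) diag_entries.
Proof.
move=> W_A; rewrite /weights /diag_entries.
rewrite -(eq_map W_A) (map_comp W (@rshift 1 N)); apply: perm_map.
apply: uniq_perm; first exact: enum_uniq.
  by rewrite map_inj_uniq ?enum_uniq //; apply: rshift_inj.
move=> i; rewrite mem_enum !inE -(splitK i); case: (split i) => j /=.
  rewrite ord1 eqxx; apply/esym/negP => /mapP[l _ /eqP].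
  by rewrite -val_eqE.
by rewrite map_f // mem_enum.
Qed.

(** The weights of I0 are the doubled ones, for any member I0 of size k of the
    support that avoids e_0. *)
Lemma closed_gc_spectrum (J : 'M[R]_((1 + N) + (1 + N))) :
  gc_structure A J -> gc_type n k J ->
  (exists2 rho, spinor_generator J rho & closed_spinor A rho) ->
  exists w0 lam zet, [/\ size lam = k, size zet = (n - k)%N,
     \sum_(l <- lam) l = 0 &
     perm_eq (w0 :: diag_entries) (doubled lam ++ with_opposites zet)].
Proof.
move=> [J2 _ _] [rho [rho0 annrho] type_rho] [sigma [sigma0 annsigma] closed_sigma].
pose W (i : 'I_(1 + N)) := if split i is inr j then A j j else 0.
have W_A j : W (rshift 1 j) = A j j.
  by rewrite /W -[rshift 1 j]/(unsplit (inr j)) unsplitK.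
have dim_g : (1 + N)%N = n.*2 by lia.
have [minrho baserho [K rK rKC]] := spinor_of_type_facts dim_g le_kn type_rho.
have graph K' : rho K' != 0 -> forall p, exists2 u, clifford u rho = 0 &
    forall q, leg (q \in K') u q = (q == p)%:R.
  move=> rK' p; have [|u /annrho] := i_eigen_graph J2 (K := K') _ p; last by exists u.
  by move=> u /annrho; apply: annihilator_leg_inj.
have exch (K1 K2 : {set 'I_(1 + N)}) p : rho K1 != 0 -> rho K2 != 0 -> p \in symdiff K1 K2 ->
    exists q, [/\ q != p, q \in symdiff K1 K2 & rho (toggle q (toggle p K1)) != 0].
  by move=> rK1; apply: (spinor_exchange rK1 (graph K1 rK1)).
have weight0 (K' : {set 'I_(1 + N)}) : o \notin K' -> rho K' != 0 -> weight W K' = 0.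
  move=> oK' rK'; have sK' : sigma K' != 0.
    apply/eqP => sK'; apply: sigma0.
    by apply: (pure_spinor_unique (graph K' rK')) => // u /annrho/annsigma.
  have cW_A j : real_complex R (W (rshift 1 j)) = cplx_mx A j j by rewrite W_A mxE.
  have := (closedP (W := fun i => real_complex R (W i)) (cplx_diag A_diag) cW_A sigma).1 closed_sigma K' oK' sK'.
  by rewrite cplx_weight => /eqP; rewrite fmorph_eq0 => /eqP.
have [I0 [oI0 rI0 cI0]] := baserho o.
have minI0 K' : rho K' != 0 -> (#|I0| <= #|K'|)%N by rewrite cI0; apply: minrho.
have [w0 [zet permW]] := support_spectrum exch weight0 rI0 oI0 minI0 rK rKC.
have szl : size (weights W I0) = k by rewrite size_map -cardE.
have permE : perm_eq (w0 :: diag_entries) (doubled (weights W I0) ++ with_opposites zet).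
  by rewrite -(permPr permW) perm_cons perm_sym perm_weights_h.
exists w0, (weights W I0), zet; split=> //.
  have := perm_size permE; rewrite size_cat size_doubled size_with_opposites szl.
  by rewrite /= size_map size_enum_ord; lia.
by rewrite -weight_sumE weight0.
Qed.

End Necessity.

(** * The Clifford relation and annihilators *)

Section CliffordRelation.
Variables (F : fieldType) (m : nat).
Implicit Types (u v : 'cV[F]_(m + m)) (rho : form F m) (K : {set 'I_m}).

Lemma pairing_leg u v :
  pairing u v = 2^-1 * \sum_i (leg true u i * leg false v i + leg true v i * leg false u i).
Proof.
rewrite /pairing /ev !mxE -big_split; congr (_ * _); apply: eq_bigr => i _.
by rewrite /leg !mxE.
Qed.

Lemma toggle_sign (i j : 'I_m) K :
  (-1) ^+ #|[set l in toggle j K | (l < i)%N]| =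
  (-1) ^+ (j < i)%N * (-1) ^+ #|[set l in K | (l < i)%N]| :> F.
Proof.
have [ji|ij] := ltnP j i; last first.
  rewrite mul1r; congr (_ ^+ _); apply: eq_card => l; rewrite !inE in_toggle.
  by have [->|] := eqVneq l j; rewrite ?ltnNge ?ij ?andbF.
have -> : [set l in toggle j K | (l < i)%N] = toggle j [set l in K | (l < i)%N].
  apply/setP => l; rewrite !(inE, in_toggle) andb_addl.
  by have [->|] := eqVneq l j; rewrite ?ji.
rewrite {1}/toggle; case: ifP => jK.
  by rewrite (cardsD1 j [set l in K | _]) jK exprD mulrA -expr2 sqrr_sign mul1r.
by rewrite cardsU1 jK exprD.
Qed.

(** In the double sum over the indices of the two generators, terms with distinct
    indices cancel in pairs: exchanging the two generators changes one sign,
    that of the order of the indices. *)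
Lemma clifford_anticomm u v rho :
  clifford u (clifford v rho) + clifford v (clifford u rho) =
  (\sum_i (leg true u i * leg false v i + leg true v i * leg false u i)) *: rho.
Proof.
apply/ffunP => K; rewrite formDE formZE.
pose s (i : 'I_m) : F := (-1) ^+ #|[set l in K | (l < i)%N]|.
pose g x y (i j : 'I_m) := s i * leg (i \in K) x i *
   ((-1) ^+ (i < j)%N * s j * leg (j \in toggle i K) y j * rho (toggle j (toggle i K))).
have cc x y : clifford x (clifford y rho) K = \sum_i \sum_j g x y i j.
  rewrite cliffordE; apply: eq_bigr => i _; rewrite cliffordE big_distrr /=.
  by apply: eq_bigr => j _; rewrite toggle_sign.
rewrite !cc [X in _ + X]exchange_big -big_split /= mulr_suml.
apply: eq_bigr => i _; rewrite -big_split (bigD1 i) //= big1 => [|j nij]; last first.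
  rewrite /g !in_toggle [i == j]eq_sym (negbTE nij) /= toggleC.
  have -> : (-1) ^+ (j < i)%N = - (-1) ^+ (i < j)%N :> F.
    have : (i : nat) != j by rewrite eq_sym.
    by case: ltngtP => // _ _; rewrite ?expr0 ?expr1 ?opprK.
  move: (_ ^+ _) (leg _ _ _) (leg _ _ _) (rho _) => a b c d; ring.
rewrite addr0 /g !in_toggle eqxx toggleK ltnn expr0 mul1r /=.
have ss : s i * s i = 1 by rewrite -expr2 sqrr_sign.
rewrite [RHS]mulrC -[RHS]mul1r -ss.
by case: (i \in K) => /=; ring.
Qed.

Lemma contractD (X : 'cV[F]_m) a b : contract X (a + b) = contract X a + contract X b.
Proof.
apply/ffunP => K; rewrite formDE !ffunE -big_split; apply: eq_bigr => i _.
by rewrite formDE mulrDr.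
Qed.

Lemma contractZ (X : 'cV[F]_m) (x : F) a : contract X (x *: a) = x *: contract X a.
Proof.
apply/ffunP => K; rewrite formZE !ffunE big_distrr; apply: eq_bigr => i _.
by rewrite formZE /= mulrCA.
Qed.

Lemma contract0 (X : 'cV[F]_m) : contract X 0 = 0.
Proof. by apply/ffunP => K; rewrite !ffunE big1 // => i _; rewrite ffunE mulr0. Qed.

Lemma contract_sum (X : 'cV[F]_m) (T : Type) (s : seq T) (P : pred T) (f : T -> form F m) :
  contract X (\sum_(i <- s | P i) f i) = \sum_(i <- s | P i) contract X (f i).
Proof. exact: (big_morph _ (contractD X) (contract0 X)). Qed.

Lemma contract1 (X : 'cV[F]_m) : contract X (mono F set0) = 0.
Proof.
apply/ffunP => K; rewrite !ffunE big1 // => i _; rewrite monoE.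
by case: eqP => [/setP/(_ i)|]; rewrite ?mulr0 // !inE eqxx.
Qed.

Lemma covec0 : covec (0 : 'cV[F]_m) = 0.
Proof. by rewrite /covec big1 // => i _; rewrite mxE scale0r. Qed.

Lemma contract_covec (X xi : 'cV[F]_m) rho : contract X (wedge (covec xi) rho) =
  (\sum_i xi i 0 * X i 0) *: rho - wedge (covec xi) (contract X rho).
Proof.
have contr0 a : contract (0 : 'cV[F]_m) a = 0.
  by apply/ffunP => K; rewrite !ffunE big1 // => i _; rewrite mxE mulr0 mul0r.
have := clifford_anticomm (col_mx X 0) (col_mx 0 xi) rho.
rewrite /clifford !col_mxKu !col_mxKd covec0 !wedge0l !contr0 !addr0 !add0r.
move/(canRL (addrK _)) => ->; congr (_ *: _ - _); apply: eq_bigr => i _.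
by rewrite /leg !col_mxEu !col_mxEd mxE mul0r add0r.
Qed.

End CliffordRelation.

Section PairingMatrix.
Variables (F : fieldType) (m : nat).
Implicit Types (u v : 'cV[F]_(m + m)).

Definition pairing_mx : 'M[F]_(m + m) := block_mx 0 1%:M 1%:M 0.

Lemma pairing_mxE u v : (u^T *m pairing_mx *m v) 0 0 =
  \sum_i (leg true u i * leg false v i + leg true v i * leg false u i).
Proof.
rewrite -{1}[u]vsubmxK -{1}[v]vsubmxK tr_col_mx /pairing_mx mul_row_block.
rewrite !mulmx0 !mulmx1 add0r addr0 mul_row_col mxE !mxE -big_split /=.
by apply: eq_bigr => i _; rewrite /leg !mxE [X in _ + X]mulrC.
Qed.

Lemma pairing_mxK : pairing_mx *m pairing_mx = 1%:M.
Proof.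
rewrite /pairing_mx mulmx_block !mulmx0 !mul0mx !mulmx1 !add0r !addr0.
by rewrite -scalar_mx_block.
Qed.

Lemma bilinear_mx_inj (M M' : 'M[F]_(m + m)) :
  (forall u v, (u^T *m M *m v) 0 0 = (u^T *m M' *m v) 0 0) -> M = M'.
Proof.
move=> h; apply/matrixP => i j; have := h (delta_mx i 0) (delta_mx j 0).
by rewrite !trmx_delta -!mulmxA -!colE -!rowE !mxE.
Qed.

End PairingMatrix.

Section SpinorGenerator.
Variables (R : realType) (m : nat) (J : 'M[R]_(m + m)) (rho : form R[i] m).
Hypotheses (J2 : J *m J = - 1%:M)
  (J_orth : forall u v, pairing (J *m u) (J *m v) = pairing u v).
Let D := cplx_mx J.

Lemma pairing_mx_orth : D^T *m pairing_mx _ _ *m D = pairing_mx _ _.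
Proof.
have JQ : J^T *m pairing_mx _ _ *m J = pairing_mx _ _.
  apply: bilinear_mx_inj => u v; have := J_orth u v.
  rewrite !pairing_leg -!pairing_mxE trmx_mul !mulmxA.
  by apply: mulfI; rewrite invr_eq0 Num.Theory.pnatr_eq0.
have Q : pairing_mx R[i] m = cplx_mx (pairing_mx R m).
  by rewrite /cplx_mx /pairing_mx map_block_mx !map_mx0 !map_mx1.
by rewrite Q /D /cplx_mx map_trmx -!map_mxM JQ.
Qed.

(** L is maximal isotropic, so a nonzero form killed by L has no larger
    annihilator: an element u of it pairs trivially with every J w + i w. *)
Lemma spinor_generatorP : rho <> 0 ->
  (forall u, i_eigen J u -> clifford u rho = 0) -> spinor_generator J rho.
Proof.
move=> rho0 Lrho; split=> // u; split=> [/Lrho//|urho].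
have D2 : D *m D = - 1%:M by rewrite /D /cplx_mx -map_mxM J2 map_mxN map_mx1.
pose Q := pairing_mx R[i] m.
have uQ0 : u^T *m Q *m (D + 'i%C%:M) = 0.
  apply/rowP => j; rewrite [RHS]mxE -[LHS]mulr1.
  pose w : 'cV[R[i]]_(m + m) := delta_mx j 0.
  have eigw : i_eigen J ((D + 'i%C%:M) *m w).
    rewrite /i_eigen -/D mulmxDl mulmxDr mulmxA D2 mul_scalar_mx scalerDr scalerA.
    by rewrite -scalemxAr mulNmx mul1mx -expr2 sqr_i scaleN1r addrC.
  have := clifford_anticomm u ((D + 'i%C%:M) *m w) rho.
  rewrite (Lrho _ eigw) urho -pairing_mxE => /esym.
  have cl0 v : clifford v (0 : form R[i] m) = 0.
    by apply/ffunP => K; rewrite cliffordE [RHS]ffunE big1 // => i _; rewrite ffunE mulr0.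
  rewrite !cl0 addr0 => /eqP; rewrite scaler_eq0 (introF eqP rho0) orbF => /eqP.
  by rewrite mulmxA -/Q /w -colE mxE mulr1.
have DTQ : D^T *m Q = - (Q *m D).
  have := congr1 (fun M => M *m D) pairing_mx_orth.
  by rewrite -mulmxA D2 mulmxN mulmx1 => <-; rewrite opprK.
have : (D *m u - 'i%C *: u)^T *m Q = 0.
  rewrite linearB linearZ /= trmx_mul mulmxBl -mulmxA DTQ mulmxN mulmxA.
  move: uQ0; rewrite mulmxDr mul_mx_scalar -scalemxAl => /eqP.
  by rewrite addr_eq0 => /eqP ->; rewrite opprK subrr.
move/(congr1 (fun M => M *m Q)); rewrite -mulmxA pairing_mxK mulmx1 mul0mx.
move/(congr1 trmx); rewrite trmxK trmx0 => /eqP; rewrite subr_eq0 => /eqP.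
by [].
Qed.

End SpinorGenerator.

Section ContractExp.
Variables (F : numFieldType) (m : nat).

(** The hypothesis says that iota_X is a derivation on multiples of b with
    iota_X b = eta; then iota_X (b^j) = j eta /\ b^(j-1), as b is central. *)
Lemma contract_exp (X : 'cV[F]_m) (b eta : exterior F m) : homogeneous 2 b ->
  (forall a, contract X (wedge b a) = wedge eta a + wedge b (contract X a)) ->
  forall a, contract X (wedge (wedge_exp b) a) =
    wedge eta (wedge (wedge_exp b) a) + wedge (wedge_exp b) (contract X a).
Proof.
move=> hb Xb a.
have Xbj j (c : exterior F m) : contract X (b ^+ j.+1 * c) =
    j.+1%:R *: (eta * (b ^+ j * c)) + b ^+ j.+1 * contract X c.
  elim: j c => [|j IH] c.
    by rewrite expr0 expr1 mul1r scale1r [LHS]Xb.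
  rewrite exprS -mulrA [LHS]Xb [contract X (b ^+ _ * c)]IH.
  rewrite [wedge b _](wedgeDr b) -[wedge b (_ *: _)]wedgeZr.
  rewrite [wedge b (eta * _)](mulrA b eta) (even_comm eta hb) //.
  rewrite -(mulrA eta) (mulrA b (b ^+ j)) -exprS.
  rewrite (mulrA b (b ^+ j.+1) (contract X c) : wedge b (b ^+ j.+1 * contract X c) = _).
  by rewrite addrA -[j.+2%:R]natr1 scalerDl scale1r [X in _ = X + _]addrC.
have Xb1 j (c : exterior F m) : contract X (wedge ((j.+1`!%:R)^-1 *: b ^+ j.+1) c) =
   wedge eta (wedge ((j`!%:R)^-1 *: b ^+ j) c) + wedge ((j.+1`!%:R)^-1 *: b ^+ j.+1) (contract X c).
  rewrite -!wedgeZl contractZ [contract X _]Xbj scalerDr scalerA -wedgeZr;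
    congr (_ *: _ + _).
  by rewrite factS natrM invfM mulrAC mulVf ?mul1r // Num.Theory.pnatr_eq0.
have ltm : (m < m.+2)%N by [].
have expS c : wedge (wedge_exp b) c =
    c + \sum_(j < m.+1) wedge ((j.+1`!%:R)^-1 *: b ^+ j.+1) c.
  rewrite (wedge_expE hb ltm) big_ord_recl expr0 fact0 invr1 scale1r wedgeDl wedge1l.
  by rewrite wedge_suml.
rewrite [in LHS]expS [X in _ = _ + X]expS contractD contract_sum.
rewrite (eq_bigr _ (fun (j : 'I_m.+1) _ => Xb1 j a)) big_split /=.
rewrite [RHS]addrCA; congr (_ + (_ + _)).
rewrite (wedge_expE hb (ltnSn m)) wedge_suml.
exact/esym/(big_morph _ (wedgeDr eta))/(mulr0 (eta : exterior F m)).
Qed.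

End ContractExp.

(** * The structure attached to a pairing of the basis *)

Section PairedStructure.
Variables (m : nat) (tau : 'I_m -> 'I_m) (neg cx : pred 'I_m).
Hypotheses (tauK : involutive tau) (neg_tau : forall i, neg (tau i) = ~~ neg i)
  (cx_tau : forall i, cx (tau i) = cx i).

Section Matrix.
Variable F : fieldType.
Implicit Types u v : 'cV[F]_(m + m).

(** With cx i the plane of i and tau i carries J e_x = - e_y, J e_y = e_x, and
    otherwise J e_x = e^y, J e_y = - e^x, where x is the member of the pair with
    neg x = false; the dual basis is acted upon likewise. *)
Definition paired_J : 'M[F]_(m + m) :=
  let P : 'M_m := \matrix_(i < m, j < m) (((j == tau i) && cx i)%:R * (-1) ^+ neg i) in
  let Q : 'M_m := \matrix_(i < m, j < m) (((j == tau i) && ~~ cx i)%:R * (-1) ^+ (~~ neg i)) in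
  block_mx P Q Q P.

Lemma paired_JE b u i : leg b (paired_J *m u) i =
  (-1) ^+ neg i * (if cx i then leg b u (tau i) else - leg (~~ b) u (tau i)).
Proof.
have sum1 (P : bool) (s : F) (f : 'I_m -> F) :
    \sum_j (((j == tau i) && P)%:R * s) * f j = if P then s * f (tau i) else 0.
  case: P; last by rewrite big1 // => j _; rewrite andbF !mul0r.
  rewrite (bigD1 (tau i)) //= big1 ?addr0 => [|j /negbTE->]; last by rewrite !mul0r.
  by rewrite eqxx mul1r.
rewrite -[in LHS](vsubmxK u) /paired_J mul_block_col /leg.
have legu j : usubmx u j 0 = u (lshift m j) 0 by rewrite mxE.
have legd j : dsubmx u j 0 = u (rshift m j) 0 by rewrite mxE.
case: b; rewrite ?col_mxEd ?col_mxEu !mxE.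
  under eq_bigr do rewrite mxE legu; under [X in _ + X]eq_bigr do rewrite mxE legd.
  rewrite !sum1; case: (cx i); rewrite ?add0r ?addr0 //=.
  by case: (neg i); rewrite ?expr0 ?expr1; ring.
under eq_bigr do rewrite mxE legu; under [X in _ + X]eq_bigr do rewrite mxE legd.
rewrite !sum1; case: (cx i); rewrite ?add0r ?addr0 //=.
by case: (neg i); rewrite ?expr0 ?expr1; ring.
Qed.

Lemma leg_inj u v : (forall b i, leg b u i = leg b v i) -> u = v.
Proof.
move=> h; apply/matrixP => i j; rewrite ord1 -(splitK i); case: (split i) => l.
  exact: (h false l).
exact: (h true l).
Qed.

Lemma legN b u i : leg b (- u) i = - leg b u i.
Proof. by rewrite /leg; case: b; rewrite mxE. Qed.

Lemma legZ b (x : F) u i : leg b (x *: u) i = x * leg b u i.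
Proof. by rewrite /leg; case: b; rewrite mxE. Qed.

Lemma paired_J2 : paired_J *m paired_J = - 1%:M.
Proof.
suff h u : paired_J *m (paired_J *m u) = - u.
  apply/matrixP => i j; have /matrixP/(_ i 0) := h (delta_mx j 0).
  by rewrite mulmxA -colE !mxE eqxx andbT.
apply: leg_inj => b i; rewrite paired_JE !paired_JE legN tauK neg_tau cx_tau negbK.
by case: (cx i); case: (neg i); rewrite ?expr0 ?expr1 ?mulN1r ?mul1r ?opprK.
Qed.

Lemma paired_J_orth u v : pairing (paired_J *m u) (paired_J *m v) = pairing u v.
Proof.
rewrite !pairing_leg; congr (_ * _); rewrite [RHS](reindex_inj (inv_inj tauK)).
apply: eq_bigr => i _; rewrite !paired_JE.
case: (cx i); case: (neg i); rewrite /= ?expr0 ?expr1; ring.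
Qed.

End Matrix.

Variable R : realType.
Implicit Types u v : 'cV[R[i]]_(m + m).

Lemma cplx_paired_J : cplx_mx (paired_J R) = paired_J R[i].
Proof.
rewrite /cplx_mx map_block_mx; congr block_mx;
  by apply/matrixP => i j; rewrite !mxE rmorphM rmorph_nat rmorph_sign.
Qed.

Lemma paired_eigenP u : i_eigen (paired_J R) u <->
  forall b i, 'i%C * leg b u i =
    (-1) ^+ neg i * (if cx i then leg b u (tau i) else - leg (~~ b) u (tau i)).
Proof.
rewrite /i_eigen cplx_paired_J; split=> [Ju b i|h].
  by rewrite -legZ -Ju paired_JE.
by apply: leg_inj => b i; rewrite paired_JE legZ h.
Qed.

End PairedStructure.

Section PairedIntegrable.
Variables (R : realType) (N : nat) (A : 'M[R]_N) (W : 'I_(1 + N) -> R).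
Hypotheses (A_diag : is_diag_mx A) (W_A : forall j, W (rshift 1 j) = A j j).
Local Notation m := (1 + N)%N.
Variables (tau : 'I_m -> 'I_m) (neg cx : pred 'I_m).
Hypotheses (tauK : involutive tau) (neg_tau : forall i, neg (tau i) = ~~ neg i)
  (cx_tau : forall i, cx (tau i) = cx i)
  (W_tau : forall i, W (tau i) = if cx i then W i else - W i).
Local Notation o := (lshift N 0 : 'I_m).
Notation C := R[i].
Let Wc i : C := real_complex R (W i).
Implicit Types u v : 'cV[C]_(m + m).

(** Up to the last sum, the bracket is X_0 D v - Y_0 D u, where X_0 and Y_0 are
    the coordinates of u and v along e_0, and D is the action of e_0, with
    weights W on vectors and - W on covectors. *)
Lemma courant_leg u v b i :
  leg b (courant (aa_bracket (cplx_mx A)) u v) i =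
  (-1) ^+ b * Wc i * (leg false u o * leg b v i - leg false v o * leg b u i) +
  (b && (i == o))%:R * \sum_j Wc j * (leg true v j * leg false u j - leg true u j * leg false v j).
Proof.
have cW_A j : Wc (rshift 1 j) = cplx_mx A j j by rewrite /Wc W_A mxE.
have br := aa_bracketE (cplx_diag A_diag) cW_A.
rewrite /courant /leg; case: b => /=; last first.
  by rewrite col_mxEu br !mxE mul0r addr0 expr0 mul1r.
have co (x eta : 'cV[C]_m) : coad (aa_bracket (cplx_mx A)) x eta i 0 =
    - (Wc i * x o 0 * eta i 0) + (i == o)%:R * \sum_j Wc j * (eta j 0 * x j 0).
  rewrite mxE /ev mxE -sumrN.
  have -> : (i == o)%:R * \sum_j Wc j * (eta j 0 * x j 0) =
      \sum_j (i == o)%:R * (Wc j * (eta j 0 * x j 0)) by rewrite big_distrr.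
  transitivity (\sum_j (- (Wc j * x o 0 * eta j 0 * (j == i)%:R) + (i == o)%:R * (Wc j * (eta j 0 * x j 0)))).
    by apply: eq_bigr => j _; rewrite [eta^T _ _]mxE br !mxE !andbT [o == i]eq_sym; ring.
  rewrite big_split /=; congr (_ + _).
  rewrite (bigD1 i) //= big1 => [|j /negbTE->]; last by rewrite mulr0 oppr0.
  by rewrite eqxx mulr1 addr0.
have us (x : 'cV[C]_(m + m)) j : usubmx x j 0 = x (lshift m j) 0 by rewrite mxE.
have ds (x : 'cV[C]_(m + m)) j : dsubmx x j 0 = x (rshift m j) 0 by rewrite mxE.
have mxBE (x y : 'cV[C]_m) : (x - y) i 0 = x i 0 - y i 0 by rewrite !mxE.
rewrite [LHS]col_mxEd [LHS]mxBE [X in X - _ = _]co [X in _ - X = _]co.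
have -> : \sum_j Wc j * (v (rshift m j) 0 * u (lshift m j) 0 - u (rshift m j) 0 * v (lshift m j) 0) =
   \sum_j Wc j * (dsubmx v j 0 * usubmx u j 0) - \sum_j Wc j * (dsubmx u j 0 * usubmx v j 0).
  by rewrite -sumrB; apply: eq_bigr => j _; rewrite !mxE mulrBr.
rewrite expr1.
rewrite [usubmx u o 0]us.
rewrite [usubmx v o 0]us.
rewrite [dsubmx u i 0]ds.
rewrite [dsubmx v i 0]ds.
move: (\sum_j _) => s1.
move: (\sum_j _) => s2.
move: (Wc i) (u _ _) (v _ _) (u _ _) (v _ _) ((_ == _)%:R) => a b c d e f.
by ring.
Qed.

(** L is stable under the action of e_0 because W is equal on complex pairs and
    opposite on symplectic ones, and for the same reason the e^0-component of
    the bracket of two elements of L cancels within each pair. *)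
Lemma paired_gc_structure : gc_structure A (paired_J tau neg cx R).
Proof.
split; first exact: paired_J2; first exact: paired_J_orth.
move=> u v; rewrite !(paired_eigenP tau neg cx) => Lu Lv b i.
pose f j := Wc j * (leg true v j * leg false u j - leg true u j * leg false v j).
have ii : ('i : C)%C * 'i%C = -1 by rewrite -expr2 sqr_i.
have Wct j : Wc (tau j) = if cx j then Wc j else - Wc j.
  by rewrite /Wc W_tau; case: ifP; rewrite ?rmorphN.
have f_tau j : f (tau j) = - f j.
  rewrite -[RHS]mul1r -[X in X * _]opprK -ii /f.
  have e1 := Lu true j; have e2 := Lu false j; have e3 := Lv true j; have e4 := Lv false j.
  have -> : - ('i%C * 'i%C) * - (Wc j * (leg true v j * leg false u j - leg true u j * leg false v j)) =
    Wc j * (('i%C * leg true v j) * ('i%C * leg false u j) - ('i%C * leg true u j) * ('i%C * leg false v j)).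
    by ring.
  rewrite e1 e2 e3 e4 Wct.
  by case: (cx j); case: (neg j); rewrite /= ?expr0 ?expr1; ring.
have sum0 : \sum_j f j = 0.
  have : \sum_j f j = - \sum_j f j.
    rewrite {1}(reindex_inj (inv_inj tauK)) -sumrN; apply: eq_bigr => j _; exact: f_tau.
  by move/eqP;
     rewrite -addr_eq0 -mulr2n -mulr_natr mulf_eq0 Num.Theory.pnatr_eq0 orbF => /eqP.
have cE b' j : leg b' (courant (aa_bracket (cplx_mx A)) u v) j =
    (-1) ^+ b' * Wc j * (leg false u o * leg b' v j - leg false v o * leg b' u j).
  by rewrite courant_leg sum0 mulr0 addr0.
rewrite !cE Wct {cE}.
move: (leg false u o) (leg false v o) (Lu b i) (Lv b i) => x y.
move: (leg b u i) (leg b v i) (leg b u (tau i)) (leg b v (tau i)) (leg (~~ b) u (tau i)) (leg (~~ b) v (tau i)).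
move=> p q p1 q1 p2 q2 ep eq.
have -> : 'i%C * ((-1) ^+ b * Wc i * (x * q - y * p)) =
    (-1) ^+ b * Wc i * (x * ('i%C * q) - y * ('i%C * p)) by ring.
rewrite ep eq; move: (Wc i) => w.
by case: (cx i); case: (neg i); case: b => /=; rewrite ?expr0 ?expr1; ring.
Qed.

End PairedIntegrable.

(** * The spinor attached to a pairing of the basis *)

Section ProductsOfCovectors.
Variables (F : numFieldType) (m : nat).
Implicit Types (a b : exterior F m) (x y : 'cV[F]_m) (i : 'I_m).

Definition basis_covec i : exterior F m := mono F [set i].
Local Notation e := basis_covec.

Lemma covec_basis x : covec x = \sum_i x i 0 *: e i.
Proof. by []. Qed.

Lemma covec_delta i : covec (delta_mx i 0) = e i.
Proof.
rewrite covec_basis (bigD1 i) //= big1 => [|j /negbTE nji].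
  by rewrite mxE !eqxx scale1r addr0.
by rewrite mxE nji scale0r.
Qed.

Lemma covecD x y : covec (x + y) = covec x + covec y.
Proof. by rewrite -big_split; apply: eq_bigr => i _; rewrite mxE scalerDl. Qed.

Lemma covecZ (c : F) x : covec (c *: x) = c *: covec x.
Proof. by rewrite scaler_sumr; apply: eq_bigr => i _; rewrite mxE scalerA. Qed.

Lemma covec_anticomm x y :
  (covec x : exterior F m) * covec y = - ((covec y : exterior F m) * covec x).
Proof.
by rewrite (wedge_supercomm (homogeneous_covec (xi := x)) (homogeneous_covec (xi := y))) expr1 scaleN1r.
Qed.

Lemma covec_sqr0 x : (covec x : exterior F m) * covec x = 0.
Proof.
have /eqP := covec_anticomm x x; rewrite -addr_eq0 -mulr2n -scaler_nat scaler_eq0.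
by rewrite Num.Theory.pnatr_eq0 /= => /eqP.
Qed.

(** Move x past the factors before it, then use that its square vanishes. *)
Lemma covec_mul_prod x (s : seq 'cV[F]_m) : x \in s ->
  (covec x : exterior F m) * \prod_(t <- s) (covec t : exterior F m) = 0.
Proof.
elim: s => // y s IH; rewrite inE big_cons mulrA => /orP[/eqP->|/IH xs].
  by rewrite covec_sqr0 mul0r.
by rewrite covec_anticomm mulNr -mulrA xs mulr0 oppr0.
Qed.

Lemma mono_mul (I J : {set 'I_m}) : [disjoint I & J] ->
  (mono F I : exterior F m) * mono F J = (-1) ^+ inversions I J *: mono F (I :|: J).
Proof.
move=> dIJ; apply/ffunP => K; rewrite formZE [LHS]wedgeE monoE.
have [sIK|nsIK] := boolP (I \subset K); last first.
  rewrite big1 => [|I' sI']; last first.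
    rewrite monoE; case: eqP => [eI|_]; last by rewrite mulr0 mul0r.
    by rewrite -eI sI' in nsIK.
  case: eqP => [eK|_]; last by rewrite mulr0.
  by rewrite eK subsetUl in nsIK.
rewrite (bigD1 I) //= big1 ?addr0 => [|I' /andP[_ /negbTE nI]]; last first.
  by rewrite monoE nI mulr0 mul0r.
rewrite !monoE eqxx mulr1; case: (K =P I :|: J) => [->|nK].
  rewrite setDUl setDv set0U (setDidPl _) ?eqxx ?mulr1 //.
  by rewrite disjoint_sym.
case: eqP => [eJ|_]; rewrite ?mulr0 //; case: nK.
by rewrite -eJ; apply/setP => i; rewrite !inE;
   case: (boolP (i \in I)) => //= /(subsetP sIK)->.
Qed.

Lemma prod_basis_covec (s : seq 'I_m) : uniq s ->
  exists b : nat, \prod_(i <- s) e i = (-1) ^+ b *: (mono F [set i in s] : exterior F m).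
Proof.
elim: s => [_|i s IH /= /andP[nis /IH[b es]]].
  by exists 0; rewrite big_nil scale1r (_ : [set _ in [::]] = set0) //; apply/setP => i;
     rewrite !inE.
exists (inversions [set i] [set j in s] + b)%N.
rewrite big_cons es -scalerAr mono_mul; last by rewrite disjoints1 inE.
rewrite scalerA -exprD addnC; congr (_ *: mono _ _).
by apply/setP => j; rewrite !inE.
Qed.

Definition pair_form (p : 'I_m * 'I_m) : exterior F m := e p.1 * e p.2.
Local Notation z := pair_form.

Lemma pair_form_homogeneous p : homogeneous 2 (z p).
Proof. by apply: (homogeneousM (p := 1) (q := 1)) => K /mono_supp->; rewrite cards1. Qed.

Lemma pair_form_sqr0 p : z p * z p = 0.
Proof.
rewrite /z mulrA -(mulrA (e p.1)) -!covec_delta (covec_anticomm (delta_mx p.2 0)).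
by rewrite mulrN mulrA covec_sqr0 mul0r oppr0 mul0r.
Qed.

Lemma pair_form_comm p a : GRing.comm (z p) a.
Proof. by apply: even_comm (pair_form_homogeneous (p := p)) _. Qed.

Lemma contract_pair_form (X : 'cV[F]_m) p a : contract X (wedge (z p) a) =
  wedge (X p.1 0 *: e p.2 - X p.2 0 *: e p.1) a + wedge (z p) (contract X a).
Proof.
have ev i : \sum_j (delta_mx i 0 : 'cV[F]_m) j 0 * X j 0 = X i 0.
  rewrite (bigD1 i) //= big1 => [|j /negbTE nji]; first by rewrite mxE !eqxx mul1r addr0.
  by rewrite mxE nji mul0r.
rewrite /z -!covec_delta -(wedgeA (covec (delta_mx p.1 0))) contract_covec ev.
rewrite contract_covec ev -(wedgeA (covec (delta_mx p.1 0))).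
move: (contract X a) (covec (delta_mx p.1 0)) (covec (delta_mx p.2 0)) => c x y.
have alg (a' c' x' y' : exterior F m) (r r' : F) :
    r *: (y' * a') - x' * (r' *: a' - y' * c') =
    (r *: y' - r' *: x') * a' + x' * (y' * c').
  by rewrite mulrBr mulrBl opprB -!scalerAl -scalerAr addrA addrAC.
exact: alg.
Qed.

Lemma pair_terms_cancel (V : lmodType F) (c x x' : F) (v v' : V) :
  c *: (x *: v' - x' *: v) + ((c * x') *: v + - (c * x) *: v') = 0.
Proof. by rewrite scalerBr !scalerA scaleNr addrA subrK subrr. Qed.

Lemma contract_pair_sum (c : F) (X : 'cV[F]_m) (s : seq ('I_m * 'I_m)) a :
  contract X (wedge (c *: \sum_(p <- s) z p) a) =
  wedge (c *: \sum_(p <- s) (X p.1 0 *: e p.2 - X p.2 0 *: e p.1)) a +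
  wedge (c *: \sum_(p <- s) z p) (contract X a).
Proof.
rewrite -!wedgeZl contractZ -scalerDr; congr (_ *: _).
rewrite !wedge_suml contract_sum -big_split; apply: eq_bigr => p _.
exact: contract_pair_form.
Qed.

Lemma conj_pair_mul (c : F) p :
  (e p.1 + c *: e p.2) * (e p.1 - c *: e p.2) = (- c *+ 2) *: z p.
Proof.
rewrite mulrDl !mulrBr -!covec_delta -!scalerAl -!scalerAr !covec_sqr0.
rewrite (covec_anticomm (delta_mx p.2 0)) !scaler0 sub0r subr0 scalerN.
by rewrite /z -!covec_delta mulr2n scalerDl !scaleNr.
Qed.

Lemma mul_pairs q (a a' b b' y w : exterior F m) (c d : F) :
  homogeneous q b -> homogeneous 1 a' -> a * a' = c *: y -> b * b' = d *: w ->
  (a * b) * (a' * b') = ((-1) ^+ (q * 1) * c * d) *: (y * w).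
Proof.
move=> hb ha' aa bb; rewrite mulrA -(mulrA a) (wedge_supercomm hb ha').
rewrite -scalerAr -scalerAl (mulrA a) aa -(mulrA _ b) bb.
by rewrite -scalerAl -scalerAr !scalerA.
Qed.

Section PowerOfSum.
Implicit Types s : seq ('I_m * 'I_m).

Lemma exprD_sqr0 a b j : GRing.comm a b -> a * a = 0 ->
  (a + b) ^+ j.+1 = b ^+ j.+1 + (a * b ^+ j) *+ j.+1.
Proof.
move=> cab aa; elim: j => [|j IH]; first by rewrite expr1 expr0 mulr1 addrC.
rewrite exprS IH mulrDl !mulrDr.
have -> : a * ((a * b ^+ j) *+ j.+1) = 0 by rewrite mulrnAr mulrA aa mul0r mul0rn.
have -> : b * ((a * b ^+ j) *+ j.+1) = (a * b ^+ j.+1) *+ j.+1.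
  by rewrite mulrnAr mulrA -cab -mulrA -exprS.
by rewrite addr0 -exprS addrCA -mulrS.
Qed.

(** The summands commute and have square zero, so the multinomial expansion only
    keeps the squarefree products. *)
Lemma pair_form_sum_pow s :
  (\sum_(p <- s) z p) ^+ size s = (size s)`!%:R *: \prod_(p <- s) z p /\
  (\sum_(p <- s) z p) ^+ (size s).+1 = 0.
Proof.
elim: s => [|p s [IH1 IH2]]; first by rewrite !big_nil expr0 scale1r expr1.
rewrite !big_cons; split=> /=.
  rewrite exprD_sqr0 ?pair_form_sqr0 //; last exact: pair_form_comm.
  rewrite IH2 add0r IH1 -scalerAr -scaler_nat scalerA -natrM factS //.
rewrite exprD_sqr0 ?pair_form_sqr0 //; last exact: pair_form_comm.
by rewrite IH2 mulr0 mul0rn addr0 exprS IH2 mulr0.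
Qed.

Definition unpair s := flatten [seq [:: p.1; p.2] | p <- s].

Lemma prod_pair_form s : \prod_(p <- s) z p = \prod_(i <- unpair s) e i.
Proof.
elim: s => [|p s IH]; first by rewrite !big_nil.
by rewrite -[unpair (p :: s)]/[:: p.1, p.2 & unpair s] !big_cons IH mulrA.
Qed.

Lemma perm_unpair s : perm_eq (unpair s) (unzip1 s ++ unzip2 s).
Proof.
elim: s => //= p s IH; rewrite perm_cons perm_sym.
by rewrite -cat1s perm_catCA /= perm_cons perm_sym.
Qed.

End PowerOfSum.

End ProductsOfCovectors.

Section PairedSpinor.
Variables (R : realType) (m : nat) (cp sp : seq ('I_m * 'I_m)).
Notation C := R[i].
Local Notation ps := (cp ++ sp).
Hypothesis pairs_enum : perm_eq (unpair ps) (enum 'I_m).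
Local Notation e := (@basis_covec C m).
Local Notation z := (@pair_form C m).

Definition pair_theta (p : 'I_m * 'I_m) : 'cV[C]_m :=
  delta_mx p.1 0 + 'i%C *: delta_mx p.2 0.

Definition pair_omega : form R m :=
  \sum_(p <- sp) wedge (mono R [set p.1]) (mono R [set p.2]).

Definition pair_Omega : exterior C m :=
  \prod_(t <- map pair_theta cp) (covec t : exterior C m).

Definition pair_spinor : form C m :=
  wedge (wedge_exp ('i%C *: cplx_form pair_omega)) pair_Omega.

Lemma cplx_pair_omega : cplx_form pair_omega = \sum_(p <- sp) z p.
Proof.
rewrite cplx_formE [LHS]twist_sum; apply: eq_bigr => p _.
by rewrite [LHS]twistM -!cplx_formE !cplx_mono.
Qed.

Lemma pair_omega_homogeneous : homogeneous 2 pair_omega.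
Proof.
rewrite homogeneousP; apply: graded_sum => p _; rewrite -homogeneousP.
by apply: (homogeneousM (p := 1) (q := 1)) => K /mono_supp->; rewrite cards1.
Qed.

Lemma covec_theta p : covec (pair_theta p) = e p.1 + 'i%C *: e p.2.
Proof. by rewrite covecD covecZ !covec_delta. Qed.

Lemma conj_covec_theta p : conj_form (covec (pair_theta p)) = e p.1 - 'i%C *: e p.2.
Proof.
rewrite covec_theta conj_formE twistD twistZ -!conj_formE !conj_mono -scaleNr.
by congr (_ + _ *: _); apply/eqP; rewrite eq_complex /= oppr0 !eqxx.
Qed.

Lemma theta_conj_theta p : (covec (pair_theta p) : exterior C m) *
  (conj_form (covec (pair_theta p)) : exterior C m) = (- 'i%C *+ 2) *: z p.
Proof.
by rewrite conj_covec_theta covec_theta conj_pair_mul.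
Qed.

(** (e^x + i e^y) /\ (e^x - i e^y) = - 2 i e^x /\ e^y. *)
Lemma Omega_conj_Omega s : exists2 c : C, c != 0 &
  let O := \prod_(t <- map pair_theta s) (covec t : exterior C m) in
  O * (conj_form O : exterior C m) = c *: \prod_(p <- s) z p.
Proof.
elim: s => [|p s [c c0 IH]].
  exists 1; rewrite ?oner_neq0 //= !big_nil scale1r mul1r conj_formE.
  exact: twist1.
pose O := \prod_(t <- map pair_theta s) (covec t : exterior C m).
have hO : homogeneous (size s) O.
  by have := homogeneous_prod_covec (s := map pair_theta s); rewrite size_map.
have hT : homogeneous 1 (conj_form (covec (pair_theta p))).
  by apply: conj_form_homogeneous; apply: homogeneous_covec.
exists ((-1) ^+ (size s * 1) * (- 'i%C *+ 2) * c).
  rewrite !mulf_neq0 ?expf_neq0 ?oppr_eq0 ?oner_eq0 //.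
  by rewrite -mulr_natr mulf_neq0 ?Num.Theory.pnatr_eq0 // oppr_eq0 -sqrf_eq0 sqr_i oppr_eq0 oner_eq0.
rewrite /= !big_cons -/O.
have -> : conj_form ((covec (pair_theta p) : exterior C m) * O) =
    (conj_form (covec (pair_theta p)) : exterior C m) * (conj_form O : exterior C m).
  by rewrite conj_formE twistM -!conj_formE.
exact: (mul_pairs hO hT (theta_conj_theta p) IH).
Qed.

(** Up to nonzero scalars w^(n-k) and Omega /\ conj Omega are the products of the
    e^x /\ e^y over the symplectic and over the complex pairs; together these
    multiply to the volume form up to sign. *)
Lemma pair_spinor_nondegenerate :
  wedge (wedge_pow (cplx_form pair_omega) (size sp))
        (wedge pair_Omega (conj_form pair_Omega)) <> 0.
Proof.
have [c c0 OO] := Omega_conj_Omega cp.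
rewrite wedge_powE cplx_pair_omega (pair_form_sum_pow C sp).1.
rewrite [wedge pair_Omega _]OO -wedgeZr -wedgeZl scalerA.
have -> : wedge (\prod_(p <- sp) z p) (\prod_(p <- cp) z p) = \prod_(i <- unpair (sp ++ cp)) e i.
  by rewrite -prod_pair_form big_cat.
have [|b ->] := @prod_basis_covec C m (unpair (sp ++ cp)).
  have -> : uniq (unpair (sp ++ cp)) = uniq (unpair ps).
    by apply: perm_uniq; rewrite /unpair !map_cat !flatten_cat perm_catC.
  by rewrite (perm_uniq pairs_enum) enum_uniq.
rewrite scalerA => /eqP; rewrite scaler_eq0 (negbTE (mono_neq0 _ _)) orbF.
rewrite !mulf_eq0 (negbTE c0) signr_eq0 Num.Theory.pnatr_eq0 /=.
by rewrite -leqn0 leqNgt fact_gt0.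
Qed.

Lemma sum_pairs (V : nmodType) (f : 'I_m -> V) :
  \sum_i f i = \sum_(p <- ps) (f p.1 + f p.2).
Proof.
rewrite -big_enum -(perm_big _ pairs_enum) /= /unpair big_flatten big_map.
by apply: eq_bigr => p _; rewrite big_cons big_seq1.
Qed.

(** exp (i w) /\ Omega is killed by X + xi as soon as iota_X kills Omega and
    xi + i iota_X w lies in the span of the factors of Omega. *)
Lemma pair_spinor_annihilated (X xi : 'cV[C]_m) :
  {in cp, forall p, X p.2 0 = 'i%C * X p.1 0 /\ xi p.2 0 = 'i%C * xi p.1 0} ->
  {in sp, forall p, xi p.2 0 = - ('i%C * X p.1 0) /\ xi p.1 0 = 'i%C * X p.2 0} ->
  contract X pair_spinor + wedge (covec xi) pair_spinor = 0.
Proof.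
move=> Xcp Xsp; have ii : ('i : C)%C * 'i%C = -1 by rewrite -expr2 sqr_i.
pose b : exterior C m := 'i%C *: cplx_form pair_omega.
pose eta : exterior C m := 'i%C *: \sum_(p <- sp) (X p.1 0 *: e p.2 - X p.2 0 *: e p.1).
have hb : homogeneous 2 b.
  by apply: homogeneousZ; apply: cplx_form_homogeneous; apply: pair_omega_homogeneous.
have Xb a : contract X (wedge b a) = wedge eta a + wedge b (contract X a).
  by rewrite /b cplx_pair_omega; apply: contract_pair_sum.
have XO s : {subset s <= cp} ->
    contract X (\prod_(t <- map pair_theta s) (covec t : exterior C m)) = 0.
  elim: s => [_|p s IH sub]; first by rewrite big_nil contract1.
  rewrite big_cons contract_covec IH => [|q qs]; last by rewrite sub // inE qs orbT.
  have -> : \sum_i pair_theta p i 0 * X i 0 = X p.1 0 + 'i%C * X p.2 0.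
    rewrite /pair_theta; under eq_bigr do rewrite !mxE mulrDl.
    rewrite big_split /=; congr (_ + _).
      by rewrite (bigD1 p.1) //= big1 ?addr0 ?eqxx ?mul1r // => i /negbTE->; rewrite mul0r.
    by rewrite (bigD1 p.2) //= big1 ?addr0 ?eqxx ?mulr1 // => i /negbTE->;
       rewrite mulr0 mul0r.
  have [-> _] := Xcp p (sub _ (mem_head _ _)).
  by rewrite mulrA ii mulN1r subrr scale0r sub0r [wedge _ 0](mulr0 (_ : exterior C m)) oppr0.
have comb : eta + covec xi = \sum_(p <- cp) xi p.1 0 *: covec (pair_theta p).
  rewrite covec_basis sum_pairs big_cat /= addrCA.
  rewrite [X in _ + X](_ : _ = 0) ?addr0; last first.
    rewrite /eta scaler_sumr -big_split big_seq big1 // => p psp /=.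
    by have [-> ->] := Xsp p psp; apply: pair_terms_cancel.
  rewrite big_seq [RHS]big_seq; apply: eq_bigr => p pcp.
  by rewrite covec_theta scalerDr scalerA mulrC; have [_ ->] := Xcp p pcp.
rewrite /pair_spinor (contract_exp hb Xb) XO //.
rewrite [wedge _ 0](mulr0 (wedge_exp b : exterior C m)) addr0 -wedgeDl comb wedge_suml.
rewrite big_seq big1 // => p pcp; rewrite -wedgeZl wedgeA.
have -> : wedge (covec (pair_theta p)) (wedge_exp b) = wedge (wedge_exp b) (covec (pair_theta p)).
  exact: (esym (wedge_exp_comm _ hb)).
rewrite -wedgeA [wedge _ pair_Omega](_ : _ = 0).
  by rewrite [wedge _ 0](mulr0 (wedge_exp b : exterior C m)) scaler0.
by apply: covec_mul_prod; apply: map_f.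
Qed.

End PairedSpinor.

Section PairLists.
Variables (R : realType) (m : nat) (cp sp : seq ('I_m * 'I_m)) (W : 'I_m -> R).
Local Notation ps := (cp ++ sp).
Hypothesis pairs_enum : perm_eq (unpair ps) (enum 'I_m).

Definition pair_tau (i : 'I_m) : 'I_m :=
  if i \in unzip1 ps then nth i (unzip2 ps) (index i (unzip1 ps))
  else nth i (unzip1 ps) (index i (unzip2 ps)).
Definition pair_neg : pred 'I_m := fun i => i \in unzip2 ps.
Definition pair_cx : pred 'I_m := fun i => i \in unpair cp.

Lemma uniq_unpair : uniq (unpair ps).
Proof. by rewrite (perm_uniq pairs_enum) enum_uniq. Qed.

Lemma uniq_unzip : uniq (unzip1 ps ++ unzip2 ps).
Proof. by rewrite -(perm_uniq (perm_unpair _)) uniq_unpair. Qed.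

Lemma mem_unpair (s : seq ('I_m * 'I_m)) p : p \in s ->
  p.1 \in unpair s /\ p.2 \in unpair s.
Proof.
by move=> ins; split; apply/flatten_mapP; exists p; rewrite ?inE ?eqxx ?orbT.
Qed.

Lemma pair_of i : exists2 p, p \in ps & i = p.1 \/ i = p.2.
Proof.
have : i \in unpair ps by rewrite (perm_mem pairs_enum) mem_enum.
by case/flatten_mapP => p pps; rewrite !inE => /orP[]/eqP->; exists p; auto.
Qed.

Lemma unzip_disjoint p q : p \in ps -> q \in ps -> p.1 != q.2.
Proof.
move=> pps qps; have := uniq_unzip; rewrite cat_uniq => /and3P[_ /hasPn h _].
by apply: contraNneq (h q.2 (map_f _ qps)) => <-; apply: map_f.
Qed.

Lemma pair_neg1 p : p \in ps -> pair_neg p.1 = false.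
Proof.
move=> pps; apply/negP => /mapP[q qps e]; have := unzip_disjoint pps qps.
by rewrite e eqxx.
Qed.

Lemma pair_neg2 p : p \in ps -> pair_neg p.2.
Proof. exact: map_f. Qed.

Lemma pair_tau1 p : p \in ps -> pair_tau p.1 = p.2.
Proof.
move=> pps; rewrite /pair_tau (map_f fst) //.
have := uniq_unzip; rewrite cat_uniq => /and3P[uX _ _].
have lt : (index p ps < size ps)%N by rewrite index_mem.
have {2}-> : p.1 = nth p.1 (unzip1 ps) (index p ps) by rewrite (nth_map p) ?nth_index.
by rewrite index_uniq ?size_map // (nth_map p) ?nth_index.
Qed.

Lemma pair_tau2 p : p \in ps -> pair_tau p.2 = p.1.
Proof.
move=> pps; rewrite /pair_tau.
have -> : (p.2 \in unzip1 ps) = false.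
  by apply/negP => /mapP[q qps e]; have := unzip_disjoint qps pps; rewrite e eqxx.
have := uniq_unzip; rewrite cat_uniq => /and3P[_ _ uY].
have lt : (index p ps < size ps)%N by rewrite index_mem.
have {2}-> : p.2 = nth p.2 (unzip2 ps) (index p ps) by rewrite (nth_map p) ?nth_index.
by rewrite index_uniq ?size_map // (nth_map p) ?nth_index.
Qed.

Lemma pair_tauK : involutive pair_tau.
Proof.
move=> i; have [p pps [->|->]] := pair_of i.
  by rewrite pair_tau1 // pair_tau2.
by rewrite pair_tau2 // pair_tau1.
Qed.

Lemma pair_neg_tau i : pair_neg (pair_tau i) = ~~ pair_neg i.
Proof.
have [p pps [->|->]] := pair_of i.
  by rewrite pair_tau1 // pair_neg1 // pair_neg2.
by rewrite pair_tau2 // pair_neg1 // pair_neg2.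
Qed.

Lemma pair_cx_cp p : p \in cp -> pair_cx p.1 /\ pair_cx p.2.
Proof. exact: mem_unpair. Qed.

Lemma pair_cx_sp p : p \in sp -> pair_cx p.1 = false /\ pair_cx p.2 = false.
Proof.
move=> psp; have [p1 p2] := mem_unpair psp.
have := uniq_unpair; rewrite /unpair map_cat flatten_cat cat_uniq.
by move=> /and3P[_ /hasPn h _]; split; apply/negbTE/h.
Qed.

Lemma pair_cx_tau i : pair_cx (pair_tau i) = pair_cx i.
Proof.
have [p pps pi] := pair_of i; move: (pps);
  rewrite mem_cat => /orP[/pair_cx_cp|/pair_cx_sp] [e1 e2];
  by case: pi => ->; rewrite ?pair_tau1 ?pair_tau2 // e1 e2.
Qed.

Lemma pair_W_tau :
  {in cp, forall p, W p.2 = W p.1} -> {in sp, forall p, W p.2 = - W p.1} ->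
  forall i, W (pair_tau i) = if pair_cx i then W i else - W i.
Proof.
move=> Wcp Wsp i; have [p pps pi] := pair_of i.
move: (pps); rewrite mem_cat => /orP[pcp|psp].
  have [e1 e2] := pair_cx_cp pcp.
  by case: pi => ->; rewrite ?pair_tau1 ?pair_tau2 // ?e1 ?e2 Wcp.
have [e1 e2] := pair_cx_sp psp.
by case: pi => ->; rewrite ?pair_tau1 ?pair_tau2 // ?e1 ?e2 Wsp // opprK.
Qed.

(** Only the factor of a pair (x, y) involves e^x. *)
Lemma pair_theta_free : free (map (@pair_theta R m) cp).
Proof.
suff h : free (map_tuple (@pair_theta R m) (in_tuple cp)) by [].
apply/freeP => c sum0 j; set t := in_tuple cp.
have := uniq_unzip; rewrite cat_uniq => /and3P[uX _ _].
have tps l : tnth t l \in ps by rewrite mem_cat mem_tnth.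
have /matrixP/(_ (tnth t j).1 0) := sum0; rewrite summxE [RHS]mxE => <-.
have coef (l : 'I_(size cp)) : ((map_tuple (@pair_theta R m) t)`_l : 'cV[R[i]]_m) (tnth t j).1 0 =
    ((tnth t j).1 == (tnth t l).1)%:R.
  rewrite -tnth_nth tnth_map !mxE !andbT (negbTE (unzip_disjoint (tps j) (tps l))).
  by rewrite mulr0 addr0.
rewrite (bigD1 j) //= big1 => [|l nlj]; rewrite mxE coef ?eqxx ?mulr1 ?addr0 //.
case: eqP => [e|_]; last by rewrite mulr0.
case/eqP: nlj; apply: val_inj; apply/eqP.
have uc : uniq (unzip1 cp) by move: uX; rewrite /unzip1 map_cat cat_uniq => /and3P[].
have p0 : 'I_m * 'I_m := tnth t j.
rewrite -(nth_uniq p0.1 _ _ uc) ?size_map ?ltn_ord // !(nth_map p0) ?ltn_ord //.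
by move: e; rewrite !(tnth_nth p0) => ->.
Qed.

Lemma pair_spinor_of_type n k : size cp = k -> size sp = (n - k)%N ->
  spinor_of_type n k (pair_spinor R cp sp).
Proof.
move=> szc szs; have szt : size (map (@pair_theta R m) cp) == k by rewrite size_map szc.
exists 0, (pair_omega R sp), 1, (Tuple szt); rewrite /= scale1r.
split.
- by split; [move=> K; rewrite ffunE eqxx | apply: pair_omega_homogeneous].
- by split; [apply/eqP; rewrite oner_eq0 | apply: pair_theta_free].
- have -> : cplx_form (0 : form R m) = 0 by apply/ffunP => K; rewrite !ffunE rmorph0.
  by rewrite add0r.
by rewrite -szs; apply: pair_spinor_nondegenerate.
Qed.

Lemma pair_spinor_neq0 n k : m = n.*2 -> (k <= n)%N -> size cp = k -> size sp = (n - k)%N ->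
  pair_spinor R cp sp <> 0.
Proof.
move=> dim_m le_kn szc szs.
have [_ _ [K nz _]] := spinor_of_type_facts dim_m le_kn (pair_spinor_of_type szc szs).
by move=> z; rewrite z ffunE eqxx in nz.
Qed.

Lemma pair_spinor_graded :
  {in cp, forall p, W p.2 = W p.1} -> {in sp, forall p, W p.2 = - W p.1} ->
  \sum_(p <- cp) W p.1 = 0 -> graded W 0 (pair_spinor R cp sp).
Proof.
move=> Wcp Wsp sumW.
have ge i : graded W (W i) (@basis_covec R[i] m i).
  by move=> K /mono_supp->; rewrite /weight big_set1.
have gb : graded W 0 ('i%C *: cplx_form (pair_omega R sp) : exterior R[i] m).
  apply: gradedZ; rewrite cplx_pair_omega big_seq; apply: graded_sum => p /Wsp Wp.
  have := gradedM (ge p.1) (ge p.2); by rewrite Wp subrr.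
rewrite -[0]addr0; apply: gradedM.
  apply: graded_sum => j _; apply: gradedZ; rewrite wedge_powE.
  by have := gradedX (j := j) gb; rewrite mul0rn.
have gO : graded W (\sum_(p <- cp | p \in cp) W p.1)
    (\prod_(p <- cp | p \in cp) (covec (pair_theta R p) : exterior R[i] m)).
  apply: graded_prod => p /Wcp Wp; rewrite covec_theta; apply: (gradedD (ge p.1)).
  by rewrite -Wp; apply: (gradedZ (ge p.2)).
by move: gO; rewrite -!big_seq sumW /pair_Omega big_map.
Qed.

Lemma pair_spinor_killed u :
  i_eigen (paired_J pair_tau pair_neg pair_cx R) u ->
  clifford u (pair_spinor R cp sp) = 0.
Proof.
move/paired_eigenP => h; have ii : ('i : R[i])%C * 'i%C = -1 by rewrite -expr2 sqr_i.
rewrite /clifford; apply: pair_spinor_annihilated => // p pin.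
  have pps : p \in ps by rewrite mem_cat pin.
  have [cx1 _] := pair_cx_cp pin.
  have := h false p.1; have := h true p.1;
    rewrite pair_neg1 // pair_tau1 // cx1 /leg !mul1r.
  by rewrite !mxE => -> ->.
have pps : p \in ps by rewrite mem_cat pin orbT.
have [cx1 cx2] := pair_cx_sp pin.
have := h false p.1; have := h false p.2.
rewrite pair_neg1 // pair_neg2 // pair_tau1 // pair_tau2 // cx1 cx2 /leg /= !mxE.
by rewrite expr1 expr0 mulN1r opprK mul1r => -> ->; rewrite opprK.
Qed.

End PairLists.

(** * Sufficiency *)

Section Enumeration.
Variables (R : realType) (m : nat) (W : 'I_m -> R).

Lemma perm_map_lift (T U : eqType) (f : T -> U) (s : seq T) (t : seq U) :
  perm_eq t (map f s) -> exists2 s', perm_eq s' s & t = map f s'.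
Proof.
elim: t s => [|y t IH] s.
  by move/perm_size; case: s => // _; exists [::].
move=> pyt; have /mapP[x xs ey] : y \in map f s by rewrite -(perm_mem pyt) mem_head.
have pxs := perm_to_rem xs.
have [|s' ps' et] := IH (rem x s).
  by rewrite -(perm_cons y) (permPl pyt) ey -map_cons perm_map.
exists (x :: s'); last by rewrite /= -ey -et.
by rewrite (permPr pxs) perm_cons.
Qed.

Lemma unpair_doubled lam t (s : seq 'I_m) : map W s = doubled lam ++ t ->
  exists cp s', [/\ s = unpair cp ++ s', map W s' = t,
    [seq W p.1 | p <- cp] = lam & {in cp, forall p, W p.2 = W p.1}].
Proof.
elim: lam s => [|l lam IH] s; first by exists [::], s.
case: s => [|x [|y s]] //=;
  rewrite -/(doubled lam) => -[Wx Wy /IH[cp [s' [-> Ws' <- Wcp]]]].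
exists ((x, y) :: cp), s'; split=> //; first by rewrite /= Wx.
by move=> p; rewrite inE => /orP[/eqP->|/Wcp//]; rewrite /= Wx.
Qed.

Lemma unpair_with_opposites zet (s : seq 'I_m) : map W s = with_opposites zet ->
  exists2 sp, s = unpair sp & size sp = size zet /\ {in sp, forall p, W p.2 = - W p.1}.
Proof.
elim: zet s => [|l zet IH] s; first by case: s => // _; exists [::].
case: s => [|x [|y s]] //=; rewrite -/(with_opposites zet) => -[Wx Wy /IH[sp -> [<- Wsp]]].
exists ((x, y) :: sp) => //; split=> // p.
by rewrite inE => /orP[/eqP->|/Wsp//]; rewrite /= Wx Wy.
Qed.

End Enumeration.

Section Sufficiency.
Variables (R : realType) (n : nat).
Hypothesis n_gt0 : (0 < n)%N.
Notation N := (n.*2.-1).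
Variables (A : 'M[R]_N) (k : nat).
Hypotheses (A_diag : is_diag_mx A) (le_kn : (k <= n)%N).
Local Notation o := (lshift N 0 : 'I_(1 + N)).

(** Giving e_0 the weight w0 makes the listed spectrum a pairing of the basis. *)
Lemma spectrum_closed_gc w0 lam zet : size lam = k -> size zet = (n - k)%N ->
  \sum_(l <- lam) l = 0 ->
  perm_eq (w0 :: diag_entries A) (doubled lam ++ with_opposites zet) ->
  exists J : 'M[R]_((1 + N) + (1 + N)),
  [/\ gc_structure A J, gc_type n k J &
      exists2 rho, spinor_generator J rho & closed_spinor A rho].
Proof.
move=> szl szz suml permA.
pose W (i : 'I_(1 + N)) := if split i is inr j then A j j else w0.
have W_A j : W (rshift 1 j) = A j j.
  by rewrite /W -[rshift 1 j]/(unsplit (inr j)) unsplitK.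
have Wo : W o = w0 by rewrite /W -[o]/(unsplit (inl _)) unsplitK.
have permW : perm_eq (doubled lam ++ with_opposites zet) (map W (enum 'I_(1 + N))).
  have -> : map W (enum 'I_(1 + N)) = weights W setT by rewrite /weights enum_setT enumT.
  rewrite -(permPl permA) perm_sym (permPl (perm_weightsD1 W (in_setT o))) Wo perm_cons.
  by rewrite setTD perm_weights_h.
have [s perms] := perm_map_lift permW.
move/esym => /unpair_doubled[cp [s' [es Ws' elam Wcp]]].
have [sp es' [szsp Wsp]] := unpair_with_opposites Ws'.
have pairs_enum : perm_eq (unpair (cp ++ sp)) (enum 'I_(1 + N)).
  by rewrite /unpair map_cat flatten_cat -/(unpair cp) -/(unpair sp) -es' -es.
have szcp : size cp = k by rewrite -szl -elam size_map.
have szsp' : size sp = (n - k)%N by rewrite szsp.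
have sumW : \sum_(p <- cp) W p.1 = 0 by move: suml; rewrite -elam big_map.
have dim_g : (1 + N)%N = n.*2 by lia.
pose J := paired_J (pair_tau cp sp) (pair_neg cp sp) (pair_cx cp) R.
have gcJ : gc_structure A J.
  apply: (paired_gc_structure A_diag W_A).
  - exact: pair_tauK.
  - exact: pair_neg_tau.
  - exact: pair_cx_tau.
  - exact: pair_W_tau.
have [J2 J_orth _] := gcJ.
have genJ : spinor_generator J (pair_spinor R cp sp).
  apply: spinor_generatorP => //.
    exact: (pair_spinor_neq0 pairs_enum dim_g le_kn szcp szsp').
  exact: pair_spinor_killed.
exists J; split=> //; exists (pair_spinor R cp sp) => //.
  exact: pair_spinor_of_type.
have cW_A j : real_complex R (W (rshift 1 j)) = cplx_mx A j j by rewrite W_A mxE.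
apply/(closedP (W := fun i => real_complex R (W i)) (cplx_diag A_diag) cW_A).
by move=> K _ /(pair_spinor_graded Wcp Wsp sumW) wK; rewrite cplx_weight wK rmorph0.
Qed.

End Sufficiency.

Theorem theorem2 (R : realType) (n : nat) (n_gt0 : (0 < n)%N)
    (A : 'M[R]_(n.*2.-1)) (A_diag : is_diag_mx A)
    (k : nat) (k_le_n : (k <= n)%N) :
  (exists J : 'M[R]_((1 + n.*2.-1) + (1 + n.*2.-1)),
     [/\ gc_structure A J, gc_type n k J
       & exists2 rho, spinor_generator J rho & closed_spinor A rho])
  <->
  ((k <= n - 1)%N /\
   exists (lambda : k.-tuple R) (mu : R) (zeta : (n - k - 1).-tuple R),
     eigenvalues_listed A (doubled lambda ++ mu :: with_opposites zeta) /\
     \sum_(l <- lambda) l = 0)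
  \/
  ((1 <= k)%N /\
   exists (lambda : (k - 1).-tuple R) (mu : R) (zeta : (n - k).-tuple R),
     eigenvalues_listed A (doubled lambda ++ mu :: with_opposites zeta) /\
     mu + \sum_(l <- lambda) l = 0).
Proof.
have shapes := spectrum_shapes (diag_entries A) n_gt0 k_le_n.
have listed s : eigenvalues_listed A s <-> perm_eq (diag_entries A) s.
  exact: eigenvalues_listedP.
split=> [[J [gcJ typeJ closedJ]]|spec].
  have /shapes := closed_gc_spectrum n_gt0 A_diag k_le_n gcJ typeJ closedJ.
  case=> -[le_k [lam [mu [zet [/listed ? ?]]]]]; [left|right];
    by split=> //; exists lam, mu, zet.
have [|w0 [lam [zet [szl szz suml permA]]]] := shapes.2.
  case: spec => -[le_k [lam [mu [zet [/listed ? ?]]]]]; [left|right];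
    by split=> //; exists lam, mu, zet.
exact: (spectrum_closed_gc n_gt0 A_diag k_le_n szl szz suml permA).
Qed.
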